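(* Let $B\in\mathbb{C}^{n_1\times\cdots\times n_m}$ be an $m$-mode tensor, let $1\le k_\ell\le n_\ell$ be integers for $1\le\ell\le m$, and let $\{(P_1^{(j)},\ldots,P_m^{(j)})\}_{j=0}^\infty$ be a sequence generated by the ASI algorithm (described in the context) from an arbitrary initial $(P_1^{(0)},\ldots,P_m^{(0)})$ with $P_\ell^{(0)}\in\mathrm{St}(k_\ell,n_\ell)$. Let $(P_{*1},\ldots,P_{*m})$ be an accumulation point of this sequence, with the subsequence $\{(P_1^{(j)},\ldots,P_m^{(j)})\}_{j\in\mathbb{I}}$ converging to it ($\mathbb{I}$ an infinite index set), and let $(\widehat P_{*1},\ldots,\widehat P_{*\,m-1})$ be an accumulation point of $\{(P_1^{(j+1)},\ldots,P_{m-1}^{(j+1)})\}_{j\in\mathbb{I}}$. For $1\le\ell\le m$ set $$H_{*\ell}:=H_\ell(P_{*1},\ldots,P_{*\,\ell-1},P_{*\,\ell+1},\ldots,P_{*m}),\qquad \widehat H_{*\ell}:=H_\ell(\widehat P_{*1},\ldots,\widehat P_{*\,\ell-1},P_{*\,\ell+1},\ldots,P_{*m}).$$ Then the following hold. (a) The sequence $\{f(P_1^{(j)},\ldots,P_m^{(j)})\}_{j=0}^\infty$ is monotonically increasing (i.e. nondecreasing) and convergent. (b) For $1\le\ell\le m$, $\widehat H_{*\ell}P_{*\ell}=P_{*\ell}\Lambda_{*\ell}$ with $\Lambda_{*\ell}=P_{*\ell}^{\mathrm H}\widehat H_{*\ell}P_{*\ell}\succeq0$; that is, each of these equations is a polar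 decomposition of $\widehat H_{*\ell}P_{*\ell}$. (c) If $\operatorname{rank}(H_{*\ell}P_{*\ell})=k_\ell$ for $1\le\ell\le m-1$, then $\widehat P_{*\ell}=P_{*\ell}$ for $1\le\ell\le m-1$, and consequently $H_{*\ell}P_{*\ell}=P_{*\ell}\Lambda_{*\ell}$ for $1\le\ell\le m$, where $\Lambda_{*\ell}=P_{*\ell}^{\mathrm H}H_{*\ell}P_{*\ell}$ satisfies $\Lambda_{*\ell}\succ0$ for $1\le\ell\le m-1$ and $\Lambda_{*m}\succeq0$. (d) If $(P_{*1},\ldots,P_{*m})$ is an isolated accumulation point of $\{(P_1^{(j)},\ldots,P_m^{(j)})\}_{j=0}^\infty$, and if $\operatorname{rank}(H_{*\ell}P_{*\ell})=k_\ell$ for $1\le\ell\le m-1$ and also $\operatorname{rank}(H_{*m}P_{*m})=k_m$, then the entire sequence $\{(P_1^{(j)},\ldots,P_m^{(j)})\}_{j=0}^\infty$ converges to $(P_{*1},\ldots,P_{*m})$. (e) For each $1\le\ell\le m$, $$\sum_{j=0}^\infty\sigma_{\min}(H_\ell^{(j)}P_\ell^{(j)})\,\big\|\sin\Theta\big(\mathcal R(P_\ell^{(j+1)}),\mathcal R(P_\ell^{(j)})\big)\big\|_{\mathrm F}^2<\infty,$$ $$\sum_{j=0}^\infty\sigma_{\min}(H_\ell^{(j)}P_\ell^{(j)})\,\frac{\big\|H_\ell^{(j)}P_\ell^{(j)}-P_\ell^{(j)}\Lambda_\ell^{(j)}\big\|_{\mathrm F}^2}{\big\|H_\ell^{(j)}\big\|_{\mathrm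 F}^2}<\infty,$$ where $\Lambda_\ell^{(j)}=[P_\ell^{(j)}]^{\mathrm H}H_\ell^{(j)}P_\ell^{(j)}\in\mathbb{C}^{k_\ell\times k_\ell}$.
   Context: Throughout $m\ge2$. $X^{\mathrm H}$ is the conjugate transpose, $\|\cdot\|_{\mathrm F}$ the Frobenius norm (for tensors: square root of the sum of squared moduli of all entries), $\mathcal R(X)$ the column space. $A\succ0$ ($\succeq0$) means $A$ is Hermitian positive definite (semidefinite). $\sigma_{\min}(X)$ for $X\in\mathbb{C}^{n\times k}$ is the smallest of its $\min\{n,k\}$ singular values. $\mathrm{St}(k,n)=\{P\in\mathbb{C}^{n\times k}: P^{\mathrm H}P=I_k\}$. Mode multiplication: for $X=[x_{ij}]\in\mathbb{C}^{k\times n_\ell}$, $B\times_\ell X$ is the tensor of size $n_1\times\cdots\times n_{\ell-1}\times k\times n_{\ell+1}\times\cdots\times n_m$ with entries $(B\times_\ell X)_{(i_1\cdots i_m)}=\sum_{j=1}^{n_\ell}x_{i_\ell j}\,b_{i_1\cdots i_{\ell-1}\,j\,i_{\ell+1}\cdots i_m}$. The $\ell$th unfolding $[\,\cdot\,]_{\mathrm{ufd},\ell}$ of a tensor is the matrix whose columns are the mode-$\ell$ fibers (the $\ell$th subscript varies, all others fixed), arranged in some fixed order (the order is immaterial). Objective: $f(P_1,\ldots,P_m)=\|B\times_1P_1^{\mathrm H}\times_2P_2^{\mathrm H}\cdots\times_mP_m^{\mathrm H}\|_{\mathrm F}^2$ for $P_\ell\in\mathrm{St}(k_\ell,n_\ell)$.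 For each $\ell$, with $(i_1,\ldots,i_{m-1})=(1,\ldots,\ell-1,\ell+1,\ldots,m)$, define $C_\ell(P_{i_1},\ldots,P_{i_{m-1}})=[B\times_{i_1}P_{i_1}^{\mathrm H}\cdots\times_{i_{m-1}}P_{i_{m-1}}^{\mathrm H}]_{\mathrm{ufd},\ell}\in\mathbb{C}^{n_\ell\times(k_{i_1}\cdots k_{i_{m-1}})}$ and $H_\ell(P_{i_1},\ldots,P_{i_{m-1}})=C_\ell(P_{i_1},\ldots,P_{i_{m-1}})\,C_\ell(P_{i_1},\ldots,P_{i_{m-1}})^{\mathrm H}\in\mathbb{C}^{n_\ell\times n_\ell}$. An orthonormal polar factor of $A\in\mathbb{C}^{n\times k}$ ($n\ge k$) is any $Q\in\mathrm{St}(k,n)$ with $A=Q\Gamma$ for some $\Gamma\succeq0$ (such a factorization is called a polar decomposition); it is unique if and only if $\operatorname{rank}(A)=k$. ASI algorithm (alternating subspace iteration, run for infinitely many steps): for $j=0,1,2,\ldots$ and, within each $j$, for $\ell=1,2,\ldots,m$ in order, set $H_\ell^{(j)}=H_\ell(P_1^{(j+1)},\ldots,P_{\ell-1}^{(j+1)},P_{\ell+1}^{(j)},\ldots,P_m^{(j)})$ and let $P_\ell^{(j+1)}\in\mathrm{St}(k_\ell,n_\ell)$ be an orthonormal polar factor of $H_\ell^{(j)}P_\ell^{(j)}$ (any choice if not unique). Canonical angles: for $X,Y\in\mathrm{St}(k,n)$, $\theta_i=\arccos\sigma_i(X^{\mathrm H}Y)\in[0,\pi/2]$, $1\le i\le k$,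 where $\sigma_i$ are singular values, and $\|\sin\Theta(\mathcal R(X),\mathcal R(Y))\|_{\mathrm F}=\big(\sum_{i=1}^k\sin^2\theta_i\big)^{1/2}$. An accumulation point of a sequence is a limit of some subsequence; it is isolated if some neighborhood of it contains no other accumulation point of the sequence. Convention: a term of the second series in (e) with $H_\ell^{(j)}=0$ is taken to be $0$. *)

(* Defs.v *)
From HB Require Import structures.
From mathcomp Require Import all_boot all_order all_algebra.
From mathcomp Require Import spectral complex.
From mathcomp Require Import boolp classical_sets functions reals topology.
From mathcomp Require Import normedtype sequences trigo.

Set Implicit Arguments.
Unset Strict Implicit.
Unset Printing Implicit Defensive.

Import Order.TTheory GRing.Theory Num.Theory.
Import numFieldNormedType.Exports.

Local Open Scope classical_set_scope.
Local Open Scope ring_scope.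
Local Open Scope sesquilinear_scope.

Section Matrices.
Variable R : realType.

Definition fnorm (n k : nat) (A : 'M[R[i]]_(n, k)) : R :=
  Num.sqrt (\sum_a \sum_b Normc.normc (A a b) ^+ 2).

Definition hermitian (k : nat) (A : 'M[R[i]]_k) : Prop := A ^t* = A.

(* In [R[i]], [0 <= z] says that z is real and nonnegative. *)
Definition posdef (k : nat) (A : 'M[R[i]]_k) : Prop :=
  hermitian A /\ forall x : 'cV_k, x != 0 -> 0 < (x ^t* *m A *m x) 0 0.

Definition possemidef (k : nat) (A : 'M[R[i]]_k) : Prop :=
  hermitian A /\ forall x : 'cV_k, 0 <= (x ^t* *m A *m x) 0 0.

Definition stiefel (n k : nat) (P : 'M[R[i]]_(n, k)) : Prop :=
  P ^t* *m P = 1%:M.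

Definition polar_decomposition (n k : nat)
    (A Q : 'M[R[i]]_(n, k)) (G : 'M[R[i]]_k) : Prop :=
  [/\ stiefel Q, possemidef G & A = Q *m G].

Definition polar_factor (n k : nat) (A Q : 'M[R[i]]_(n, k)) : Prop :=
  exists G : 'M[R[i]]_k, polar_decomposition A Q G.

(* The min(n, k) singular values in nonincreasing order: the square roots of
   the largest min(n, k) eigenvalues, counted with multiplicity, of the normal
   matrix A^H A; when n < k, the k - n eigenvalues dropped are zero. *)
Definition singular_values (n k : nat) (A : 'M[R[i]]_(n, k)) : seq R :=
  take (minn n k)
    (sort >=%R
       [seq Num.sqrt (complex.Re (spectral_diag (A ^t* *m A) 0 a))
       | a <- enum 'I_k]).

Definition sigma_min (n k : nat) (A : 'M[R[i]]_(n, k)) : R :=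
  last 0 (singular_values A).

Definition canonical_angle (n k : nat) (X Y : 'M[R[i]]_(n, k)) (a : 'I_k) : R :=
  acos (singular_values (X ^t* *m Y))`_a.

Definition sinTheta_norm (n k : nat) (X Y : 'M[R[i]]_(n, k)) : R :=
  Num.sqrt (\sum_a sin (canonical_angle X Y a) ^+ 2).

End Matrices.

Notation multi_index d := {dffun forall s, 'I_(d s)}.

Section Tensors.
Variables (R : realType) (m : nat).
Implicit Types (d : 'I_m -> nat) (l : 'I_m) (q : nat).


Definition tensor d : Type := {ffun multi_index d -> R[i]}.

Definition tensor_norm d (T : tensor d) : R :=
  Num.sqrt (\sum_i Normc.normc (T i) ^+ 2).

Definition set_dim d l q : 'I_m -> nat := fun s => if s == l then q else d s.

Lemma set_dim_same d l q : set_dim d l q l = q.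
Proof. by rewrite /set_dim eqxx. Qed.

Lemma set_dim_diff d l q s : s <> l -> set_dim d l q s = d s.
Proof. by move=> /eqP/negPf sl; rewrite /set_dim sl. Qed.

(* The multi-index i with its l-th entry replaced by j; the casts only
   transport entries along equalities of dimensions. *)
Definition set_index d l q (i : multi_index (set_dim d l q)) (j : 'I_(d l)) :
    multi_index d :=
  [ffun s => match s =P l with
             | ReflectT e => cast_ord (congr1 d (esym e)) j
             | ReflectF ne => cast_ord (set_dim_diff d q ne) (i s)
             end].

Definition mode_mul d l q (X : 'M[R[i]]_(q, d l)) (T : tensor d) :
    tensor (set_dim d l q) :=
  [ffun i : multi_index (set_dim d l q) => \sum_(j < d l)
     X (cast_ord (set_dim_same d l q) (i l)) j * T (set_index i j)].

(* The columns are the mode-l fibers; each is labelled by a multi-index whose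
   l-th entry ranges over 'I_1, that is, by the subscripts other than the
   l-th. *)
Definition unfolding d l (T : tensor d) :
    'M[R[i]]_(d l, #|{: multi_index (set_dim d l 1)}|) :=
  \matrix_(a, c) T (set_index (enum_val c) a).

End Tensors.

Section Tucker.
Variables (R : realType) (m : nat) (n k : 'I_m -> nat).
Implicit Types (r : seq 'I_m) (l s : 'I_m).

Definition dims_after d r : 'I_m -> nat :=
  foldl (fun e l => set_dim e l (k l)) d r.

Lemma dims_after_notin d r l : l \notin r -> dims_after d r l = d l.
Proof.
elim: r d => //= a r IH d; rewrite inE negb_or => /andP[/negPf la lr].
by rewrite /dims_after /= [LHS]IH // /set_dim la.
Qed.

(* T x_{l1} X_{l1} x_{l2} X_{l2} ... for r = [:: l1; l2; ...]. Starting from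
   d = n with r duplicate-free, the l-th dimension is still n l when mode l is
   reached, so that [conform_mx 0 (X l)] is X l itself and never the default
   value 0. *)
Fixpoint mode_mul_seq (X : forall l, 'M[R[i]]_(k l, n l)) r :
    forall d, tensor R d -> tensor R (dims_after d r) :=
  match r with
  | [::] => fun d T => T
  | l :: r' => fun d T =>
      mode_mul_seq X r' (mode_mul (conform_mx (0 : 'M_(k l, d l)) (X l)) T)
  end.

Definition factors : Type := forall l, 'M[R[i]]_(n l, k l).

Definition objective (B : tensor R n) (P : factors) : R :=
  tensor_norm (mode_mul_seq (fun l => (P l) ^t*) (enum 'I_m) B) ^+ 2.

Definition other_modes l : seq 'I_m := [seq s <- enum 'I_m | s != l].

Lemma other_modes_notin l : l \notin other_modes l.
Proof. by rewrite mem_filter eqxx. Qed.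

(* [Cmx] and [Hmx] do not depend on the l-th component of P. *)
Definition Cmx (B : tensor R n) l (P : factors) :=
  castmx (dims_after_notin n (other_modes_notin l), erefl)
    (unfolding l (mode_mul_seq (fun s => (P s) ^t*) (other_modes l) B)).

Definition Hmx (B : tensor R n) l (P : factors) : 'M[R[i]]_(n l) :=
  Cmx B l P *m (Cmx B l P) ^t*.

(* (P'_1, ..., P'_(l-1), P_l, ..., P_m) *)
Definition mix l (P' P : factors) : factors :=
  fun s => if (s < l)%N then P' s else P s.

Definition H_iter (B : tensor R n) (P : nat -> factors) l (j : nat) :
    'M[R[i]]_(n l) :=
  Hmx B l (mix l (P j.+1) (P j)).

Definition ASI_sequence (B : tensor R n) (P : nat -> factors) : Prop :=
  (forall l, stiefel (P 0%N l)) /\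
  forall j l, polar_factor (H_iter B P l j *m P j l) (P j.+1 l).

(* Convergence and accumulation of the components with index in D only. *)
Definition converges_on (D : pred 'I_m) (P : nat -> factors) (Q : factors) :
    Prop :=
  forall l, D l -> fnorm (P j l - Q l) @[j --> \oo] --> (0 : R).

Definition accumulation_on (D : pred 'I_m) (P : nat -> factors) (Q : factors) :
    Prop :=
  exists psi : nat -> nat, {homo psi : i j / (i < j)%N} /\
    converges_on D (P \o psi) Q.

Definition isolated_accumulation (P : nat -> factors) (Q : factors) : Prop :=
  accumulation_on predT P Q /\
  exists2 eps : R, 0 < eps &
    forall Q' : factors, accumulation_on predT P Q' ->
      (forall l, fnorm (Q' l - Q l) < eps) -> forall l, Q' l = Q l.

End Tucker.

(* Main.v *)
(* Write [X], [Y] for the old and new l-th factor, [H = C C^H] for the matrix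
   of the update and [H X = Y G] for its polar decomposition. The objective is
   [|X^H C|^2] as a function of the l-th factor alone, and one update raises it
   by at least [Re tr (D G D^H)] with [D = Y - X]. Diagonalizing [G], this
   bounds [sigma_min (H X) |D|^2] and [|D G|^2 / |H X|]. The first bound
   dominates the terms of both series in (e), which then telescope. Since the
   gains tend to 0, the second gives [Y G - X G -> 0], that is
   [H X - X G -> 0], so every limit satisfies [H X = X (X^H H X)]; when
   [X^H H X] is invertible, [Y] has the same limit as [X]. For (d), if the
   sequence left a small ball around the isolated point infinitely often, a
   subsequence of the exit times would converge to that point by compactness,
   and so would the following iterates, a contradiction. *)

Require Import Defs.
From mathcomp Require Import all_boot all_order all_algebra.
From mathcomp Require Import spectral complex.
From mathcomp Require Import boolp classical_sets functions reals topology.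
From mathcomp Require Import normedtype sequences realfun trigo ring lra.
Set Implicit Arguments.
Unset Strict Implicit.
Unset Printing Implicit Defensive.
Import Order.TTheory GRing.Theory Num.Theory.
Import numFieldNormedType.Exports.
Local Open Scope classical_set_scope.
Local Open Scope ring_scope.
Local Open Scope sesquilinear_scope.

Local Notation Re := complex.Re.
Local Notation Im := complex.Im.
Local Notation normc := Normc.normc.

(** * Mode products *)

Section Embedding.
Variables (R : realType) (m N : nat).
Implicit Types (d : 'I_m -> nat) (l : 'I_m).

(* Once [N] bounds every dimension, multi-indices of all shapes embed into the
   single box [J], where mode products are commuting operators free of casts. *)
Let J := {ffun 'I_m -> 'I_N.+1}.

Definition embed d (t : multi_index d) : J := [ffun s => inord (t s)].

Definition in_box d (i : J) := [forall s, (i s < d s)%N].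

(** Extension by zero outside the box of [d]. When [N.+1] bounds [d], [embed] is injective and the
    sum has at most one term; it stands in for a partial inverse of [embed]. *)
Definition extend d (T : tensor R d) (i : J) : R[i] := \sum_(t | embed t == i) T t.

Definition update (i : J) l (j : 'I_N.+1) : J :=
  [ffun s => if s == l then j else i s].

(** Extension by zero to all natural indices. The result type does not mention [q] and [p], so equal
    dimensions require no casts. *)
Definition padded q p (X : 'M[R[i]]_(q, p)) (a b : nat) : R[i] :=
  match (insub a : option 'I_q), (insub b : option 'I_p) with
  | Some a', Some b' => X a' b'
  | _, _ => 0
  end.

Definition mode_op (M : nat -> nat -> R[i]) l (F : J -> R[i]) : J -> R[i] :=
  fun i => \sum_(j < N.+1) M (i l) j * F (update i l j).

Lemma embedE d (t : multi_index d) s :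
  (forall s, d s <= N.+1)%N -> embed t s = t s :> nat.
Proof. by move=> dN; rewrite ffunE inordK // (leq_trans (ltn_ord _)). Qed.

Lemma embed_inj d : (forall s, d s <= N.+1)%N -> injective (@embed d).
Proof.
move=> dN t u tu; apply/ffunP => s; apply: val_inj => /=.
by rewrite -(embedE t s dN) tu embedE.
Qed.

Lemma embed_in_box d (t : multi_index d) :
  (forall s, d s <= N.+1)%N -> in_box d (embed t).
Proof. by move=> dN; apply/forallP => s; rewrite embedE. Qed.

Lemma in_boxP d i : (forall s, d s <= N.+1)%N -> in_box d i ->
  exists t : multi_index d, i = embed t.
Proof.
move=> dN /forallP ib; exists [ffun s => Ordinal (ib s)].
by apply/ffunP => s; apply: val_inj; rewrite /= embedE // ffunE.
Qed.

Lemma extend_embed d (T : tensor R d) t :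
  (forall s, d s <= N.+1)%N -> extend T (embed t) = T t.
Proof.
move=> dN; rewrite /extend (eq_bigl (pred1 t)) ?big_pred1_eq // => u /=.
by apply/eqP/eqP => [/(embed_inj dN)|->].
Qed.

Lemma extend_out d (T : tensor R d) i :
  (forall s, d s <= N.+1)%N -> ~~ in_box d i -> extend T i = 0.
Proof.
move=> dN ib; rewrite /extend big1 // => t /eqP ti.
by move: ib; rewrite -ti embed_in_box.
Qed.

Lemma padded_ord q p (X : 'M[R[i]]_(q, p)) (a : 'I_q) (b : 'I_p) :
  padded X a b = X a b.
Proof. by rewrite /padded !valK. Qed.

Lemma padded_row_out q p (X : 'M[R[i]]_(q, p)) a b :
  (q <= a)%N -> padded X a b = 0.
Proof. by move=> qa; rewrite /padded insubF // ltnNge qa. Qed.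

Lemma padded_col_out q p (X : 'M[R[i]]_(q, p)) a b :
  (p <= b)%N -> padded X a b = 0.
Proof.
by move=> pb; rewrite /padded; case: insub => // a'; rewrite insubF // ltnNge pb.
Qed.

Lemma padded_conform q p p' (X : 'M[R[i]]_(q, p)) :
  p' = p -> padded (conform_mx (0 : 'M_(q, p')) X) = padded X.
Proof. by move=> e; subst p'; rewrite conform_mx_id. Qed.

Lemma sum_embed (V : nmodType) d (f : J -> V) : (forall s, d s <= N.+1)%N ->
  (forall i, ~~ in_box d i -> f i = 0) ->
  \sum_i f i = \sum_(t : multi_index d) f (embed t).
Proof.
move=> dN f0; rewrite [RHS](partition_big (@embed d) predT) //=.
apply: eq_bigr => i _; have [ib|/[dup] ib /f0 ->] := boolP (in_box d i).
  have [t ->] := in_boxP dN ib.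
  rewrite (eq_bigl (pred1 t)) ?big_pred1_eq // => u /=.
  by apply/eqP/eqP => [/(embed_inj dN)|->].
by rewrite big1 // => t /eqP ti; move: ib; rewrite -ti embed_in_box.
Qed.

(** Each slice [i l = j] is parametrized by the slice [i l = ord0], whose points serve as labels of
    the mode-[l] fibers. *)
Lemma sum_slice (V : nmodType) l (f : J -> V) :
  \sum_i f i = \sum_(j < N.+1) \sum_(i : J | i l == ord0) f (update i l j).
Proof.
rewrite (partition_big (fun i : J => i l) predT) //=; apply: eq_bigr => j _.
rewrite (reindex_onto (fun i => update i l j) (fun i => update i l ord0)) /=.
  apply: eq_bigl => i; rewrite !ffunE !eqxx /=.
  apply/eqP/eqP => [<-|i0]; first by rewrite !ffunE eqxx.
  by apply/ffunP => s; rewrite !ffunE; case: eqP => // ->.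
move=> i /eqP ij; apply/ffunP => s; rewrite !ffunE.
by case: eqP => // ->.
Qed.

Section Unfold.
Variables (d : 'I_m -> nat) (l : 'I_m) (q : nat).
Hypotheses (dN : forall s, (d s <= N.+1)%N) (qN : (q <= N.+1)%N).

Lemma set_dim_bounded s : (set_dim d l q s <= N.+1)%N.
Proof. by rewrite /set_dim; case: ifP. Qed.

Lemma embed_set_index (t : multi_index (set_dim d l q)) (j : 'I_(d l)) :
  embed (set_index t j) = update (embed t) l (inord j).
Proof.
apply/ffunP => s; apply: val_inj; rewrite [LHS]/= embedE // !ffunE.
case: (s =P l) => [e|ne] /=; last first.
  by rewrite inordK // (leq_trans (ltn_ord _)) ?set_dim_bounded.
by subst s; rewrite inordK ?(leq_trans (ltn_ord j)).
Qed.

End Unfold.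

Lemma update_update i l a b : update (update i l a) l b = update i l b.
Proof. by apply/ffunP => s; rewrite !ffunE; case: eqP. Qed.

Lemma update_id i l : update i l (i l) = i.
Proof. by apply/ffunP => s; rewrite !ffunE; case: eqP => // ->. Qed.

(** Both [update] and [set_index] overwrite entry [l] of [t], so [q] is free: it is the new
    dimension in [extend_mode_mul], and [1] in [mode_op_unfolding]. *)
Lemma mode_op_fiber d l q p (X : 'M[R[i]]_(p, d l)) (T : tensor R d)
    (t : multi_index (set_dim d l q)) (b : 'I_N.+1) :
  (forall s, d s <= N.+1)%N -> (q <= N.+1)%N ->
  mode_op (padded X) l (extend T) (update (embed t) l b) =
  \sum_(j < d l) padded X b j * T (set_index t j).
Proof.
move=> dN qN; rewrite /mode_op ffunE eqxx.
rewrite (bigID (fun j : 'I__ => (j < d l)%N)) /= [X in _ + X]big1 ?addr0; last first.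
  by move=> j; rewrite -leqNgt => /(padded_col_out X) ->; rewrite mul0r.
transitivity (\sum_(j < N.+1 | (j < d l)%N) padded X b j *
    extend T (update (embed t) l (inord j))).
  by apply: eq_bigr => j _; rewrite update_update inord_val.
rewrite -(big_ord_widen _ (fun j : nat => padded X b j *
  extend T (update (embed t) l (inord j)))) ?dN //.
by apply: eq_bigr => j _; rewrite -(extend_embed T) // embed_set_index.
Qed.

Lemma extend_mode_mul d l q (X : 'M[R[i]]_(q, d l)) (T : tensor R d) :
  (forall s, d s <= N.+1)%N -> (q <= N.+1)%N ->
  extend (mode_mul X T) = mode_op (padded X) l (extend T).
Proof.
move=> dN qN; apply/funext => i.
have dN' := set_dim_bounded l dN qN.
have [ib|ib] := boolP (in_box (set_dim d l q) i).
  have [t ->] := in_boxP dN' ib; rewrite extend_embed // ffunE.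
  rewrite -[in RHS](update_id (embed t) l) mode_op_fiber //.
  apply: eq_bigr => j _; rewrite embedE //; congr (_ * _).
  by rewrite -[RHS]/(padded X (cast_ord (set_dim_same d l q) (t l)) j) padded_ord.
(* Outside the box every term vanishes: if entry [l] is too large, it meets a zero row of
   [padded X]; any other excessive entry leaves the box of [T]. *)
rewrite extend_out //; case/forallPn: (ib) => s; rewrite -leqNgt => ds.
rewrite /mode_op big1 // => j _.
have [sl|sl] := eqVneq s l.
  by subst s; rewrite padded_row_out ?mul0r // -{1}(set_dim_same d l q).
rewrite extend_out ?mulr0 //; apply/forallPn; exists s.
by rewrite -leqNgt ffunE (negPf sl) -(@set_dim_diff _ d l q) //; apply/eqP.
Qed.

Lemma tensor_norm_extend d (T : tensor R d) : (forall s, d s <= N.+1)%N ->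
  tensor_norm T ^+ 2 = \sum_i normc (extend T i) ^+ 2.
Proof.
move=> dN; rewrite sqr_sqrtr; last by apply: sumr_ge0 => i _; exact: sqr_ge0.
rewrite (sum_embed (d := d)) // => [|i ib].
  by apply: eq_bigr => t _; rewrite extend_embed.
by rewrite extend_out // Normc.normc0 expr0n.
Qed.

(** A product in mode [l] multiplies every mode-[l] fiber by [X], and these fibers are the columns
    of the unfolding. Slices with [b >= q] contribute zero. *)
Lemma mode_op_unfolding d l q (X : 'M[R[i]]_(q, d l)) (T : tensor R d) :
  (forall s, d s <= N.+1)%N -> (q <= N.+1)%N ->
  \sum_i normc (mode_op (padded X) l (extend T) i) ^+ 2 =
  fnorm (X *m unfolding l T) ^+ 2.
Proof.
move=> dN qN; rewrite sqr_sqrtr; last first.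
  by apply: sumr_ge0 => a _; apply: sumr_ge0 => b _; exact: sqr_ge0.
have dN1 := set_dim_bounded l dN (ltn0Sn N).
rewrite (sum_slice l).
transitivity (\sum_(b < N.+1) \sum_(c : multi_index (set_dim d l 1))
    normc (\sum_(j < d l) padded X b j * T (set_index c j)) ^+ 2).
  apply: eq_bigr => b _; rewrite big_mkcond /= (sum_embed (d := set_dim d l 1)) //.
    apply: eq_bigr => c _; rewrite mode_op_fiber //.
    rewrite ifT // -val_eqE /= embedE //.
    have := ltn_ord (c l); rewrite [X in (_ < X)%N]set_dim_same.
    by case: (nat_of_ord _).
  move=> i /forallPn[s]; rewrite -leqNgt => ds.
  case: ifP => // /eqP il.
  have sl : s != l by apply: contraTneq ds => ->; rewrite il set_dim_same.
  rewrite /mode_op big1 ?Normc.normc0 ?expr0n // => j _.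
  rewrite extend_out ?mulr0 //; apply/forallPn; exists s.
  by rewrite -leqNgt !ffunE (negPf sl) -(@set_dim_diff _ d l 1) //; apply/eqP.
rewrite (bigID (fun b : 'I__ => (b < q)%N)) /= [X in _ + X]big1 ?addr0; last first.
  move=> b; rewrite -leqNgt => qb; rewrite big1 // => c _.
  rewrite big1 ?Normc.normc0 ?expr0n // => j _.
  by rewrite padded_row_out ?mul0r.
rewrite -(big_ord_widen _ (fun b : nat => \sum_(c : multi_index (set_dim d l 1))
    normc (\sum_(j < d l) padded X b j * T (set_index c j)) ^+ 2)) ?qN //.
apply: eq_bigr => b _; rewrite (reindex _ (onW_bij _ (@enum_val_bij _))) /=.
apply: eq_bigr => c _; rewrite !mxE; congr (normc _ ^+ 2).
by apply: eq_bigr => j _; rewrite padded_ord mxE.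
Qed.

Lemma mode_opC M M' l l' F : l != l' ->
  mode_op M l (mode_op M' l' F) = mode_op M' l' (mode_op M l F).
Proof.
move=> ll; apply/funext => i; rewrite /mode_op.
under eq_bigr do rewrite mulr_sumr.
rewrite exchange_big; apply: eq_bigr => b _; rewrite mulr_sumr.
apply: eq_bigr => a _; rewrite !ffunE [l' == l]eq_sym (negPf ll) mulrCA.
congr (_ * (_ * F _)); apply/ffunP => s; rewrite !ffunE.
by case: eqP => // ->; rewrite [l' == l]eq_sym (negPf ll).
Qed.

(** Products in distinct modes commute, so the one in mode [l] can be moved to the end. *)
Lemma foldl_mode_opC (M : 'I_m -> nat -> nat -> R[i]) l M' r F : l \notin r ->
  foldl (fun F s => mode_op (M s) s F) (mode_op M' l F) r =
  mode_op M' l (foldl (fun F s => mode_op (M s) s F) F r).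
Proof.
elim: r F => //= a r IH F; rewrite inE negb_or => /andP[la lr].
by rewrite -IH // mode_opC // eq_sym.
Qed.

Lemma extend_mode_mul_seq n k (X : forall l, 'M[R[i]]_(k l, n l)) r d
    (T : tensor R d) : uniq r -> {in r, d =1 n} ->
  (forall s, d s <= N.+1)%N -> (forall s, k s <= N.+1)%N ->
  extend (mode_mul_seq X r T) =
  foldl (fun F s => mode_op (padded (X s)) s F) (extend T) r.
Proof.
elim: r d T => //= a r IH d T /andP[ar ur] dn dN kN.
rewrite IH //.
- by rewrite extend_mode_mul // padded_conform // dn // mem_head.
- move=> s sr; rewrite /set_dim; case: eqP => [sa|_].
    by move: ar; rewrite -sa sr.
  by rewrite dn // inE sr orbT.
- by move=> s; apply: set_dim_bounded.
Qed.

Lemma dims_after_bounded (k : 'I_m -> nat) d r : (forall s, d s <= N.+1)%N ->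
  (forall s, k s <= N.+1)%N -> forall s, (dims_after k d r s <= N.+1)%N.
Proof.
elim: r d => //= a r IH d dN kN s; rewrite [X in (X <= _)%N]/(dims_after k _ r s).
by apply: IH => // s'; apply: set_dim_bounded.
Qed.

End Embedding.

(** Trades the cast in [Cmx] for the [conform_mx] found in [mode_mul_seq]. *)
Lemma mulmx_castmx_conform (A : nzRingType) q p p' c (e : p' = p)
    (Y : 'M[A]_(q, p)) (U : 'M_(p', c)) :
  Y *m castmx (e, erefl) U = conform_mx (0 : 'M_(q, p')) Y *m U.
Proof. by subst p'; rewrite castmx_id conform_mx_id. Qed.

Lemma eq_mode_mul_seq (R : realType) m (n k : 'I_m -> nat)
    (X Y : forall l, 'M[R[i]]_(k l, n l)) r d (T : tensor R d) :
  {in r, forall s, X s = Y s} -> mode_mul_seq X r T = mode_mul_seq Y r T.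
Proof.
elim: r d T => //= a r IH d T XY; rewrite XY ?mem_head // IH // => s sr.
by rewrite XY // inE sr orbT.
Qed.

(** * The objective as a function of one factor *)

Section Objective.
Variables (R : realType) (m : nat) (n k : 'I_m -> nat).
Variable B : tensor R n.
Implicit Types (P Q : factors R n k) (l : 'I_m).

(* Contracting mode [l] last turns the objective into a function of the [l]-th
   factor alone. *)
Lemma objectiveE P l :
  objective B P = fnorm ((P l) ^t* *m Cmx B l P) ^+ 2.
Proof.
(* Any common bound of all [n s] and [k s] would serve as the size of the box. *)
pose N := (\sum_s (n s + k s))%N.
have leN s : (n s + k s <= N.+1)%N.
  by rewrite /N (bigD1 s) //= -addSn (leq_trans (leqnSn _)) ?leq_addr.
have nN s : (n s <= N.+1)%N by apply: leq_trans (leN s); apply: leq_addr.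
have kN s : (k s <= N.+1)%N by apply: leq_trans (leN s); apply: leq_addl.
pose X s : 'M[R[i]]_(k s, n s) := (P s) ^t*.
have uo : uniq (other_modes l) by rewrite filter_uniq ?enum_uniq.
have dl := dims_after_notin k n (other_modes_notin l).
have dN := dims_after_bounded (other_modes l) nN kN.
rewrite /Cmx mulmx_castmx_conform -(mode_op_unfolding (N := N)) //.
rewrite padded_conform // extend_mode_mul_seq //.
rewrite /objective (tensor_norm_extend (N := N)); last exact: dims_after_bounded.
rewrite extend_mode_mul_seq ?enum_uniq //.
apply: eq_bigr => i _; congr (normc (_ i) ^+ 2).
have := enum_uniq 'I_m; rewrite /other_modes.
have /splitPr[r1 r2] : l \in enum 'I_m by rewrite mem_enum.
rewrite cat_uniq /= negb_or => /and3P[_ /andP[l1 _] /andP[l2 _]].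
rewrite filter_cat /= eqxx !foldl_cat /= foldl_mode_opC //=.
have notin_filter r : l \notin r -> [seq s <- r | s != l] = r.
  by move=> lr; apply/all_filterP/allP => s sr; apply: contraNneq lr => <-.
by rewrite !notin_filter.
Qed.

Lemma eq_Cmx P Q l : (forall s, s != l -> P s = Q s) -> Cmx B l P = Cmx B l Q.
Proof.
move=> PQ; rewrite /Cmx; congr (castmx _ (unfolding l _)).
apply: eq_mode_mul_seq => s; rewrite mem_filter => /andP[sl _].
by rewrite PQ.
Qed.

End Objective.

(** * Frobenius norm and spectrum *)

Section FrobeniusNorm.
Variable R : realType.
Implicit Types n k p : nat.

Lemma trmxC_mul n k p (A : 'M[R[i]]_(n, k)) (B : 'M_(k, p)) :
  (A *m B) ^t* = B ^t* *m A ^t*.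
Proof. by rewrite trmx_mul map_mxM. Qed.

Lemma trmxCD n k (A B : 'M[R[i]]_(n, k)) : (A + B) ^t* = A ^t* + B ^t*.
Proof. by rewrite linearD /= map_mxD. Qed.

Lemma trmxCN n k (A : 'M[R[i]]_(n, k)) : (- A) ^t* = - A ^t*.
Proof. by rewrite linearN /= map_mxN. Qed.

Lemma conjC_conjc (z : R[i]) : Num.conj z = conjc z.
Proof. by []. Qed.

Lemma Re_sum (I : finType) (F : I -> R[i]) : Re (\sum_a F a) = \sum_a Re (F a).
Proof. exact: (raddf_sum (@complex.Re R)). Qed.

Lemma ReD (x y : R[i]) : Re (x + y) = Re x + Re y.
Proof. by case: x y => ? ? []. Qed.

Lemma ReN (x : R[i]) : Re (- x) = - Re x.
Proof. by case: x. Qed.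

Lemma Re_mulr_real (z : R[i]) (x : R) : Re (z * real_complex R x) = x * Re z.
Proof. by case: z => a b; rewrite /= mulr0 subr0 mulrC. Qed.

Lemma Re_conj (z : R[i]) : Re (Num.conj z) = Re z.
Proof. by case: z. Qed.

Lemma Re_mulC_conj (z : R[i]) : Re (z * Num.conj z) = normc z ^+ 2.
Proof.
case: z => a b; rewrite conjC_conjc /= sqr_sqrtr ?addr_ge0 ?sqr_ge0 //.
by rewrite mulrN opprK.
Qed.

Lemma Re_trC n (A : 'M[R[i]]_n) : Re (\tr (A ^t*)) = Re (\tr A).
Proof.
rewrite /mxtrace !Re_sum; apply: eq_bigr => a _.
by rewrite !mxE Re_conj.
Qed.

Lemma Re_trD n (A B : 'M[R[i]]_n) : Re (\tr (A + B)) = Re (\tr A) + Re (\tr B).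
Proof. by rewrite mxtraceD ReD. Qed.

Lemma Re_trN n (A : 'M[R[i]]_n) : Re (\tr (- A)) = - Re (\tr A).
Proof. by rewrite [\tr _]raddfN ReN. Qed.

Lemma fnorm_ge0 n k (A : 'M[R[i]]_(n, k)) : 0 <= fnorm A.
Proof. exact: sqrtr_ge0. Qed.

Lemma fnorm_sq n k (A : 'M[R[i]]_(n, k)) :
  fnorm A ^+ 2 = \sum_a \sum_b normc (A a b) ^+ 2.
Proof.
rewrite sqr_sqrtr //; apply: sumr_ge0 => a _; apply: sumr_ge0 => b _.
exact: sqr_ge0.
Qed.

Lemma fnorm_sq_tr n k (A : 'M[R[i]]_(n, k)) :
  fnorm A ^+ 2 = Re (\tr (A *m A ^t*)).
Proof.
rewrite fnorm_sq /mxtrace Re_sum; apply: eq_bigr => a _.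
by rewrite mxE Re_sum; apply: eq_bigr => b _; rewrite !mxE Re_mulC_conj.
Qed.

Lemma fnorm_inj n k n' k' (A : 'M[R[i]]_(n, k)) (B : 'M[R[i]]_(n', k')) :
  fnorm A ^+ 2 = fnorm B ^+ 2 -> fnorm A = fnorm B.
Proof. by move/eqP; rewrite eqrXn2 ?fnorm_ge0 // => /eqP. Qed.

Lemma fnorm_trC n k (A : 'M[R[i]]_(n, k)) : fnorm (A ^t*) = fnorm A.
Proof.
by apply: fnorm_inj; rewrite !fnorm_sq_tr trmxCK mxtrace_mulC.
Qed.

Lemma fnorm_sqD n k (A B : 'M[R[i]]_(n, k)) :
  fnorm (A + B) ^+ 2 = fnorm A ^+ 2 + fnorm B ^+ 2 + 2 * Re (\tr (A *m B ^t*)).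
Proof.
rewrite !fnorm_sq_tr trmxCD mulmxDl !mulmxDr !Re_trD.
rewrite -[Re (\tr (B *m A ^t*))]Re_trC trmxC_mul trmxCK.
by rewrite mulr2n mulrDl mul1r [X in _ + X]addrC addrACA.
Qed.

Lemma fnormN n k (A : 'M[R[i]]_(n, k)) : fnorm (- A) = fnorm A.
Proof. by apply: fnorm_inj; rewrite !fnorm_sq_tr trmxCN mulNmx mulmxN opprK. Qed.

Lemma fnorm_mul_isometry n k p (Q : 'M[R[i]]_(n, k)) (A : 'M_(k, p)) :
  stiefel Q -> fnorm (Q *m A) = fnorm A.
Proof.
move=> QQ; apply: fnorm_inj; rewrite -[in LHS]fnorm_trC -[in RHS]fnorm_trC.
rewrite !fnorm_sq_tr !trmxCK trmxC_mul.
by rewrite mulmxA -[A^t* *m _ *m Q]mulmxA QQ mulmx1.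
Qed.

Lemma fnorm_stiefel n k (Q : 'M[R[i]]_(n, k)) :
  stiefel Q -> fnorm Q ^+ 2 = k%:R.
Proof.
move=> QQ; rewrite -fnorm_trC fnorm_sq_tr trmxCK QQ mxtrace1.
by rewrite -(rmorph_nat (real_complex R)).
Qed.

Lemma stiefel1 n : stiefel (1%:M : 'M[R[i]]_n).
Proof. by rewrite /stiefel trmx1 map_mx1 mulmx1. Qed.

(** Pythagoras for the orthogonal projection [X X^H] onto the column space of [X]. *)
Lemma fnorm_proj n k p (X : 'M[R[i]]_(n, k)) (Y : 'M_(n, p)) : stiefel X ->
  fnorm (Y - X *m (X ^t* *m Y)) ^+ 2 = fnorm Y ^+ 2 - fnorm (X ^t* *m Y) ^+ 2.
Proof.
move=> XX; rewrite fnorm_sqD fnormN fnorm_mul_isometry //.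
rewrite trmxCN mulmxN Re_trN trmxC_mul mulmxA mxtrace_mulC mulmxA.
by rewrite -fnorm_sq_tr; ring.
Qed.

Lemma fnorm_adj_isometry_le n k p (X : 'M[R[i]]_(n, k)) (Y : 'M_(n, p)) :
  stiefel X -> fnorm (X ^t* *m Y) <= fnorm Y.
Proof.
move=> XS; have XY := fnorm_proj Y XS; rewrite -ler_sqr ?nnegrE ?fnorm_ge0 //.
by rewrite -subr_ge0 -XY sqr_ge0.
Qed.

Lemma fnorm_col n (x : 'cV[R[i]]_n) :
  (x ^t* *m x) 0 0 = real_complex R (fnorm x ^+ 2).
Proof.
rewrite -fnorm_trC fnorm_sq big_ord1 mxE rmorph_sum /=; apply: eq_bigr => a _.
rewrite !mxE -[normc _ ^+ 2]Re_mulC_conj conjCK mulrC.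
have /complex_realP[y ->] // : x a 0 * Num.conj (x a 0) \is Num.real.
by rewrite ger0_real // mul_conjC_ge0.
Qed.

Lemma possemidef_gram n k (A : 'M[R[i]]_(n, k)) : possemidef (A ^t* *m A).
Proof.
split=> [|x]; first by rewrite /Defs.hermitian trmxC_mul trmxCK.
rewrite mulmxA -trmxC_mul -mulmxA fnorm_col ler0c; exact: sqr_ge0.
Qed.

End FrobeniusNorm.

(** * Eigenvalues, singular values and canonical angles *)

Section Spectrum.
Variable R : realType.
Implicit Types n k : nat.

Definition eigs k (G : 'M[R[i]]_k) (a : 'I_k) : R := Re (spectral_diag G 0 a).

Section Possemidef.
Variables (k : nat) (G : 'M[R[i]]_k).
Hypothesis Gpsd : possemidef G.

Let V := spectralmx G.
Let L : 'rV_k := \row_a real_complex R (eigs G a).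

Lemma unitary_spectral : V *m V ^t* = 1%:M /\ V ^t* *m V = 1%:M.
Proof.
have VV : V *m V ^t* = 1%:M by apply/unitarymxP/spectral_unitarymx.
by split => //; apply: mulmx1C.
Qed.

Lemma spectral_raw : G = V ^t* *m diag_mx (spectral_diag G) *m V.
Proof.
have : G \is normalmx by apply/normalmxP; rewrite Gpsd.1.
move=> /orthomx_spectralP; rewrite invmx_unitary //.
exact: spectral_unitarymx.
Qed.

(** The diagonal entry is [x^H G x] for [x = V^H e_a]. *)
Lemma spectral_diag_ge0 a : 0 <= spectral_diag G 0 a.
Proof.
have [VV _] := unitary_spectral.
have := Gpsd.2 (V ^t* *m delta_mx a 0).
rewrite {1}spectral_raw trmxC_mul trmxCK !mulmxA -[_ *m V *m V^t*]mulmxA VV.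
rewrite mulmx1 -[_ *m V *m V^t*]mulmxA VV mulmx1.
rewrite mul_mx_diag mxE (bigD1 a) //= !mxE !eqxx /= conjC1 mul1r mulr1.
by rewrite big1 ?addr0 // => b ba; rewrite !mxE (negPf ba) mulr0.
Qed.

Lemma eigs_ge0 a : 0 <= eigs G a.
Proof. by have := spectral_diag_ge0 a; rewrite lecE => /andP[]. Qed.

Lemma spectral_psd : G = V ^t* *m diag_mx L *m V.
Proof.
have -> : L = spectral_diag G; last exact: spectral_raw.
apply/rowP => a; rewrite mxE RRe_real //.
by rewrite ger0_real // spectral_diag_ge0.
Qed.

Lemma tr_eigs : Re (\tr G) = \sum_a eigs G a.
Proof.
rewrite {1}spectral_psd mxtrace_mulC mulmxA unitary_spectral.1 mul1mx.
rewrite mxtrace_diag Re_sum; apply: eq_bigr => a _ /=.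
by rewrite mxE.
Qed.

Lemma eigs_vector a :
  exists2 x : 'cV_k, fnorm x = 1 & fnorm (G *m x) = eigs G a.
Proof.
have [VV V'V] := unitary_spectral.
have VS : stiefel (V ^t*) by rewrite /stiefel trmxCK.
have n1 : fnorm (delta_mx a 0 : 'cV[R[i]]_k) = 1.
  rewrite /fnorm (bigD1 a) //= big_ord1 mxE !eqxx Normc.normc1 expr1n.
  rewrite big1 ?addr0 ?sqrtr1 // => b ba.
  by rewrite big_ord1 mxE (negPf ba) Normc.normc0 expr0n.
exists (V ^t* *m delta_mx a 0); first by rewrite fnorm_mul_isometry.
rewrite {1}spectral_psd -[X in fnorm X]mulmxA [V *m _]mulmxA VV mul1mx.
rewrite -mulmxA fnorm_mul_isometry // mul_diag_mx.
apply/eqP; rewrite -(@eqrXn2 _ 2) ?fnorm_ge0 ?eigs_ge0 // fnorm_sq.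
rewrite (bigD1 a) //= big_ord1 !mxE !eqxx mulr1 /= expr0n addr0 sqrtr_sqr.
rewrite ger0_norm ?eigs_ge0 // big1 ?addr0 // => b ba.
by rewrite big_ord1 !mxE (negPf ba) mulr0 Normc.normc0 expr0n.
Qed.

(** Take for [w a] the squared norm of column [a] of [D V^H], that is, of [D] written in an
    eigenbasis of [G]. Inequalities between the three quantities then become termwise comparisons of
    eigenvalues. *)
Lemma eigs_weights n (D : 'M[R[i]]_(n, k)) : exists w : 'I_k -> R,
  [/\ forall a, 0 <= w a, fnorm D ^+ 2 = \sum_a w a,
      Re (\tr (D *m G *m D ^t*)) = \sum_a eigs G a * w a
    & fnorm (D *m G) ^+ 2 = \sum_a eigs G a ^+ 2 * w a].
Proof.
have [VV V'V] := unitary_spectral.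
pose E := D *m V ^t*.
have fV (X : 'M_(n, k)) : fnorm (X *m V) = fnorm X.
  rewrite -fnorm_trC trmxC_mul fnorm_mul_isometry ?fnorm_trC //.
  by rewrite /stiefel trmxCK.
exists (fun a => \sum_b normc (E b a) ^+ 2); split.
- by move=> a; apply: sumr_ge0 => b _; apply: sqr_ge0.
- have -> : D = E *m V by rewrite -mulmxA V'V mulmx1.
  by rewrite fV fnorm_sq exchange_big.
- have -> : D *m G *m D ^t* = E *m diag_mx L *m E ^t*.
    by rewrite {1}spectral_psd trmxC_mul trmxCK !mulmxA.
  rewrite mul_mx_diag /mxtrace Re_sum /=.
  under [RHS]eq_bigr do rewrite mulr_sumr.
  rewrite exchange_big; apply: eq_bigr => b _; rewrite mxE Re_sum.
  apply: eq_bigr => a _; rewrite !mxE mulrAC -Re_mulC_conj.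
  exact: Re_mulr_real.
- have -> : D *m G = E *m diag_mx L *m V by rewrite {1}spectral_psd !mulmxA.
  rewrite fV mul_mx_diag fnorm_sq exchange_big; apply: eq_bigr => a _.
  rewrite mulr_sumr; apply: eq_bigr => b _; rewrite !mxE Normc.normcM exprMn mulrC.
  by rewrite /= expr0n addr0 sqrtr_sqr ger0_norm ?eigs_ge0.
Qed.

Lemma fnorm_eigs : fnorm G ^+ 2 = \sum_a eigs G a ^+ 2.
Proof.
have [VV V'V] := unitary_spectral.
have VS : stiefel (V ^t*) by rewrite /stiefel trmxCK.
rewrite {1}spectral_psd -mulmxA fnorm_mul_isometry // mul_diag_mx fnorm_sq.
apply: eq_bigr => a _; under eq_bigr do rewrite mxE Normc.normcM exprMn.
rewrite -mulr_sumr !mxE /= expr0n addr0 sqrtr_sqr ger0_norm ?eigs_ge0 //.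
suff -> : \sum_b normc (V a b) ^+ 2 = 1 by rewrite mulr1.
have /matrixP/(_ a a)/(congr1 (@complex.Re R)) := VV.
rewrite mxE Re_sum !mxE eqxx /= => <-.
by apply: eq_bigr => b _; rewrite !mxE Re_mulC_conj.
Qed.

Lemma eigs_le_fnorm a : eigs G a <= fnorm G.
Proof.
rewrite -ler_sqr ?nnegrE ?eigs_ge0 ?fnorm_ge0 //.
rewrite fnorm_eigs (bigD1 a) //= lerDl.
by apply: sumr_ge0 => b _; apply: sqr_ge0.
Qed.

Lemma fnorm_mul_psd_le n (D : 'M[R[i]]_(n, k)) :
  fnorm (D *m G) <= fnorm D * fnorm G.
Proof.
rewrite -ler_sqr ?nnegrE ?mulr_ge0 ?fnorm_ge0 // exprMn.
have [w [w0 -> _ ->]] := eigs_weights D.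
rewrite mulr_suml; apply: ler_sum => a _; rewrite mulrC ler_wpM2l //.
by rewrite ler_sqr ?nnegrE ?eigs_ge0 ?fnorm_ge0 ?eigs_le_fnorm.
Qed.

End Possemidef.

Lemma singular_values_sort n k (A : 'M[R[i]]_(n, k)) : (k <= n)%N ->
  singular_values A =
  sort >=%R [seq Num.sqrt (eigs (A ^t* *m A) a) | a <- enum 'I_k].
Proof.
by move=> kn; rewrite /singular_values (minn_idPr kn) take_oversize // size_sort
  size_map size_enum_ord.
Qed.

(** For [k <= n] no singular value is cut off, and the last entry of a nonincreasing list is its
    minimum. *)
Lemma sigma_min_eigs n k (A : 'M[R[i]]_(n, k)) a : (k <= n)%N ->
  0 <= sigma_min A <= Num.sqrt (eigs (A ^t* *m A) a).
Proof.
move=> kn; rewrite /sigma_min singular_values_sort //.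
set s := sort _ _.
have : Num.sqrt (eigs (A ^t* *m A) a) \in s.
  by rewrite mem_sort; apply: map_f; rewrite mem_enum.
have s0 x : x \in s -> 0 <= x.
  by rewrite mem_sort => /mapP[b _ ->]; apply: sqrtr_ge0.
have : sorted >=%R s by apply: sort_sorted => x y; apply: le_total.
case: s s0 => // x0 s s0 ss xs; rewrite -[last 0 _]/(last x0 s).
rewrite s0 ?mem_last // andTb.
move: xs => /(nthP x0)[b bs <-].
have ge_trans : transitive (>=%R : rel R) by move=> x y z /[swap]; apply: le_trans.
have ge_refl : reflexive (>=%R : rel R) by move=> x; apply: lexx.
rewrite -[last x0 s]/(last x0 (x0 :: s)) -nth_last.
by apply: (sorted_leq_nth ge_trans ge_refl x0 ss); rewrite ?inE.
Qed.

(** Rayleigh quotient: [|A x|^2 = x^H (A^H A) x] is a sum of eigenvalues of [A^H A] with nonnegative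
    weights of total [|x|^2 = 1]. *)
Lemma sigma_min_le n k (A : 'M[R[i]]_(n, k)) (x : 'cV_k) : (0 < k <= n)%N ->
  0 <= sigma_min A /\ (fnorm x = 1 -> sigma_min A <= fnorm (A *m x)).
Proof.
case/andP=> k0 kn; have Apsd := possemidef_gram A.
have /andP[s0 _] := sigma_min_eigs A (Ordinal k0) kn.
split=> // x1; rewrite -ler_sqr ?nnegrE ?fnorm_ge0 //.
have [w [w0 wx xw _]] := eigs_weights Apsd (x ^t*).
move: xw; rewrite trmxCK !mulmxA -trmxC_mul -mulmxA -fnorm_trC fnorm_sq_tr trmxCK.
move=> ->; rewrite -[leLHS]mulr1 -[X in _ * X](expr1n _ 2) -x1 -fnorm_trC wx.
rewrite mulr_sumr; apply: ler_sum => a _; rewrite ler_wpM2r //.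
rewrite -[leRHS]sqr_sqrtr; last exact: eigs_ge0.
have /andP[_ le_s] := sigma_min_eigs A a kn.
by rewrite ler_sqr ?nnegrE ?sqrtr_ge0.
Qed.

(** Each term is [sin (acos s) ^ 2 = 1 - s^2], and the squares of the singular values of [W = X^H Y]
    add up to [tr (W^H W) = |W|^2]. *)
Lemma sinTheta_norm_sq n k (X Y : 'M[R[i]]_(n, k)) : stiefel X -> stiefel Y ->
  sinTheta_norm X Y ^+ 2 = k%:R - fnorm (X ^t* *m Y) ^+ 2.
Proof.
move=> XS YS; rewrite sqr_sqrtr; last by apply: sumr_ge0 => a _; exact: sqr_ge0.
set W := X ^t* *m Y; have Wpsd := possemidef_gram W.
pose s := [seq Num.sqrt (eigs (W ^t* *m W) a) | a <- enum 'I_k].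
have sz : size (sort >=%R s) = k by rewrite size_sort size_map size_enum_ord.
transitivity (\sum_(x <- sort >=%R s) sin (acos x) ^+ 2).
  rewrite [RHS](big_nth 0) big_mkord sz; apply: eq_bigr => a _.
  by rewrite /canonical_angle singular_values_sort.
rewrite (perm_big s) ?perm_sort //= big_map big_enum /=.
have -> : fnorm W ^+ 2 = \sum_a eigs (W ^t* *m W) a.
  by rewrite -tr_eigs // -fnorm_trC fnorm_sq_tr trmxCK.
rewrite -[k in k%:R]card_ord -sumr_const -sumrB; apply: eq_bigr => a _.
have g0 := eigs_ge0 Wpsd a.
(* This puts the singular value into the domain of [acos]. The eigenvalue is [|W^H W x|] for a unit
   vector [x], and isometries and their adjoints do not increase the norm. *)
have g1 : eigs (W ^t* *m W) a <= 1.
  have [x x1 <-] := eigs_vector Wpsd a.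
  rewrite -mulmxA {1}/W trmxC_mul trmxCK -mulmxA.
  rewrite (le_trans (fnorm_adj_isometry_le _ YS)) // fnorm_mul_isometry //.
  rewrite -mulmxA (le_trans (fnorm_adj_isometry_le _ XS)) //.
  by rewrite fnorm_mul_isometry // x1.
rewrite sin_acos ?sqr_sqrtr ?subr_ge0 //.
by rewrite (le_trans (lerN10 _)) ?sqrtr_ge0 // -[leRHS]sqrtr1 ler_wsqrtr.
Qed.

End Spectrum.

(** * One polar update *)

Section PolarStep.
Variables (R : realType) (n k p : nat).
Variables (C : 'M[R[i]]_(n, p)) (X Y : 'M[R[i]]_(n, k)) (G : 'M[R[i]]_k).
Hypotheses (XS : stiefel X) (YS : stiefel Y) (Gpsd : possemidef G).

Let H := C *m C ^t*.
Let D := Y - X.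

Hypothesis HXG : H *m X = Y *m G.

(** By [objectiveE], the increase of the objective when [X] is replaced by [Y], if [C] is the matrix
    [Cmx] of the mode. *)
Definition polar_gain := fnorm (Y ^t* *m C) ^+ 2 - fnorm (X ^t* *m C) ^+ 2.

(* [|Y^H C|^2 = |X^H C|^2 + |D^H C|^2 + 2 Re tr (D^H Y G)], and since X and Y
   have orthonormal columns the last term equals [Re tr (D G D^H)]. *)
Lemma polar_gain_ge : Re (\tr (D *m G *m D ^t*)) <= polar_gain.
Proof.
rewrite /polar_gain.
have -> : Y ^t* *m C = X ^t* *m C + D ^t* *m C.
  by rewrite -mulmxDl -trmxCD addrC subrK.
rewrite fnorm_sqD.
have -> : \tr (X ^t* *m C *m (D ^t* *m C) ^t*) = \tr (D *m G *m Y ^t*).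
  rewrite trmxC_mul trmxCK mulmxA -[_ *m C *m _]mulmxA.
  rewrite -[C *m _]/H -[X ^t* *m H]trmxCK trmxC_mul trmxCK.
  have -> : H ^t* = H by rewrite /H trmxC_mul trmxCK.
  rewrite HXG trmxC_mul Gpsd.1 mxtrace_mulC mulmxA.
  by [].
suff -> : 2 * Re (\tr (D *m G *m Y ^t*)) = Re (\tr (D *m G *m D ^t*)).
  have le_sum (a b t : R) : 0 <= b -> t <= a + b + t - a by lra.
  exact: le_sum (sqr_ge0 _).
have GX : Re (\tr (X *m G *m Y ^t*)) = Re (\tr (Y *m G *m X ^t*)).
  by rewrite -Re_trC !trmxC_mul trmxCK Gpsd.1 mulmxA.
have GS (Z : 'M_(n, k)) : stiefel Z -> \tr (Z *m G *m Z ^t*) = \tr G.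
  by move=> ZZ; rewrite -mulmxA mxtrace_mulC -mulmxA ZZ mulmx1.
rewrite /D trmxCD trmxCN mulmxDr mulmxN !mulmxBl !(Re_trD, Re_trN).
by rewrite !GS // GX; ring.
Qed.

Lemma polar_gain_ge0 : 0 <= polar_gain.
Proof.
apply: le_trans polar_gain_ge; have [w [w0 _ -> _]] := eigs_weights Gpsd D.
by apply: sumr_ge0 => a _; rewrite mulr_ge0 ?eigs_ge0.
Qed.

Let fnormG : fnorm G = fnorm (H *m X).
Proof. by rewrite HXG fnorm_mul_isometry. Qed.

(** With the weights of [D], compare [g^2 w <= |G| g w] for each eigenvalue [g] of [G]; moreover
    [|G| = |H X|] because [Y] is an isometry. No rank condition enters. *)
Lemma polar_diff_le : fnorm (D *m G) ^+ 2 <= fnorm (H *m X) * polar_gain.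
Proof.
have [w [w0 _ Dw ->]] := eigs_weights Gpsd D.
rewrite -fnormG (le_trans _ (ler_wpM2l (fnorm_ge0 _) polar_gain_ge)) // Dw.
rewrite mulr_sumr; apply: ler_sum => a _; rewrite expr2 -mulrA ler_wpM2r //.
  by rewrite mulr_ge0 ?eigs_ge0.
exact: eigs_le_fnorm.
Qed.

Hypothesis kn : (0 < k <= n)%N.

(** Every eigenvalue of [G] is [|G x| = |Y G x| = |H X x|] for some unit vector [x], hence at least
    [sigma_min (H X)]. *)
Lemma sigma_min_diff_le : sigma_min (H *m X) * fnorm D ^+ 2 <= polar_gain.
Proof.
apply: le_trans polar_gain_ge; have [w [w0 -> -> _]] := eigs_weights Gpsd D.
rewrite mulr_sumr; apply: ler_sum => a _; rewrite ler_wpM2r //.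
have [x x1 <-] := eigs_vector Gpsd a.
rewrite -(fnorm_mul_isometry _ YS) mulmxA -HXG.
by have [_] := sigma_min_le (H *m X) x kn; apply.
Qed.

Let sigma_ge0 : 0 <= sigma_min (H *m X).
Proof. by have [] := sigma_min_le (H *m X) 0 kn. Qed.

(** Expanding [|Y^H X - I|^2 >= 0] gives [k - |Y^H X|^2 <= 2 k - 2 Re tr (Y^H X) = |Y - X|^2]. *)
Lemma sinTheta_step_le :
  sigma_min (H *m X) * sinTheta_norm Y X ^+ 2 <= polar_gain.
Proof.
apply: le_trans sigma_min_diff_le; rewrite ler_wpM2l //.
rewrite sinTheta_norm_sq //.
have := sqr_ge0 (fnorm (Y ^t* *m X - 1%:M)).
rewrite !fnorm_sqD !fnormN !trmxCN (fnorm_stiefel XS) (fnorm_stiefel YS).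
rewrite trmx1 map_mx1 !mulmxN mulmx1.
rewrite !Re_trN (fnorm_stiefel (stiefel1 R k)).
by rewrite -[Re (\tr (Y *m _))]Re_trC trmxC_mul trmxCK mxtrace_mulC; lra.
Qed.

(** The residual is [(I - X X^H) D G]. The projection does not increase the norm of [D], and
    [|G| = |H X| <= |H|]. *)
Lemma residual_step_le :
  sigma_min (H *m X) *
  (fnorm (H *m X - X *m (X ^t* *m H *m X)) ^+ 2 / fnorm H ^+ 2) <= polar_gain.
Proof.
apply: le_trans sigma_min_diff_le; rewrite ler_wpM2l //.
(* If [H = 0], the quotient is [x / 0 = 0]. *)
have [H0|H0] := eqVneq (fnorm H) 0.
  by rewrite H0 expr0n invr0 mulr0 sqr_ge0.
have Hgt0 : 0 < fnorm H by rewrite lt0r H0 fnorm_ge0.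
rewrite (ler_pdivrMr _ _ (exprn_gt0 2 Hgt0)).
have -> : H *m X - X *m (X ^t* *m H *m X) = (D - X *m (X ^t* *m D)) *m G.
  rewrite -[X ^t* *m H *m X]mulmxA HXG /D mulmxBr XS mulmxBr mulmx1 opprB addrA.
  by rewrite subrK mulmxBl !mulmxA.
rewrite -exprMn ler_sqr ?nnegrE ?mulr_ge0 ?fnorm_ge0 //.
rewrite (le_trans (fnorm_mul_psd_le Gpsd _)) // ler_pM ?fnorm_ge0 //.
  rewrite -ler_sqr ?nnegrE ?fnorm_ge0 // fnorm_proj // lerBlDr lerDl.
  exact: sqr_ge0.
rewrite fnormG -fnorm_trC trmxC_mul.
by rewrite -[leRHS]fnorm_trC fnorm_adj_isometry_le.
Qed.

End PolarStep.

(** * Limits *)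

Section Limits.
Variable R : realType.

Lemma homo_ltn_ge (psi : nat -> nat) :
  {homo psi : i j / (i < j)%N} -> forall j, (j <= psi j)%N.
Proof. by move=> psiH; elim=> // j IH; apply: leq_ltn_trans IH (psiH _ _ _). Qed.

Lemma cvg_subseq (T : Type) (F : set_system T) (psi : nat -> nat) (u : nat -> T) :
  {homo psi : i j / (i < j)%N} -> u @ \oo --> F -> (u \o psi) @ \oo --> F.
Proof.
move=> psiH uF A /uF [N _ NA]; exists N => // j Nj; apply: NA.
exact: leq_trans Nj (homo_ltn_ge psiH j).
Qed.

Definition cvgc (u : nat -> R[i]) (a : R[i]) :=
  (fun j => Re (u j)) @ \oo --> Re a /\ (fun j => Im (u j)) @ \oo --> Im a.

Lemma cvgc_cst a : cvgc (fun=> a) a.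
Proof. by split; apply: cvg_cst. Qed.

Lemma cvgcD u v a b : cvgc u a -> cvgc v b -> cvgc (fun j => u j + v j) (a + b).
Proof.
case: a b => a1 a2 [b1 b2] [u1 u2] [v1 v2]; split.
  rewrite (_ : (fun=> _) = (fun j => Re (u j) + Re (v j))); first exact: cvgD.
  by apply/funext => j; case: (u j) (v j) => ? ? [].
rewrite (_ : (fun=> _) = (fun j => Im (u j) + Im (v j))); first exact: cvgD.
by apply/funext => j; case: (u j) (v j) => ? ? [].
Qed.

Lemma cvgcM u v a b : cvgc u a -> cvgc v b -> cvgc (fun j => u j * v j) (a * b).
Proof.
case: a b => a1 a2 [b1 b2] [u1 u2] [v1 v2]; split.
  rewrite (_ : (fun=> _) = (fun j => Re (u j) * Re (v j) - Im (u j) * Im (v j))).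
    by apply: cvgB; apply: cvgM.
  by apply/funext => j; case: (u j) (v j) => ? ? [].
rewrite (_ : (fun=> _) = (fun j => Re (u j) * Im (v j) + Im (u j) * Re (v j))).
  by apply: cvgD; apply: cvgM.
by apply/funext => j; case: (u j) (v j) => ? ? [].
Qed.

Lemma cvgc_conj u a : cvgc u a -> cvgc (fun j => Num.conj (u j)) (Num.conj a).
Proof.
case: a => a1 a2 [u1 u2]; split.
  rewrite (_ : (fun=> _) = (fun j => Re (u j))) //.
  by apply/funext => j; case: (u j).
rewrite (_ : (fun=> _) = (fun j => - Im (u j))); first exact: cvgN.
by apply/funext => j; case: (u j).
Qed.

Lemma cvgr_sum (I : finType) (u : I -> nat -> R) a :
  (forall t, u t @ \oo --> a t) -> (fun j => \sum_t u t j) @ \oo --> \sum_t a t.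
Proof.
move=> ua; elim: (index_enum I) => [|t s IH].
  by rewrite big_nil; under [fun=> _]funext do rewrite big_nil; apply: cvg_cst.
rewrite big_cons; under [fun=> _]funext do rewrite big_cons.
exact: cvgD.
Qed.

Lemma cvgc_sum (I : finType) (u : I -> nat -> R[i]) a :
  (forall t, cvgc (u t) (a t)) -> cvgc (fun j => \sum_t u t j) (\sum_t a t).
Proof.
move=> ua; elim: (index_enum I) => [|t s IH].
  by rewrite big_nil; under [fun=> _]funext do rewrite big_nil; apply: cvgc_cst.
rewrite big_cons; under [fun=> _]funext do rewrite big_cons.
exact: cvgcD.
Qed.

Lemma cvgc_unique u a b : cvgc u a -> cvgc u b -> a = b.
Proof.
case: a b => a1 a2 [b1 b2] [u1 u2] [v1 v2].
by rewrite /= in u1 u2 v1 v2; rewrite (cvg_unique _ u1 v1) ?(cvg_unique _ u2 v2).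
Qed.

Definition mcvg n k (A : nat -> 'M[R[i]]_(n, k)) (A0 : 'M[R[i]]_(n, k)) :=
  forall a b, cvgc (fun j => A j a b) (A0 a b).

Lemma mcvg_subseq n k (A : nat -> 'M[R[i]]_(n, k)) A0 (psi : nat -> nat) :
  {homo psi : i j / (i < j)%N} -> mcvg A A0 -> mcvg (A \o psi) A0.
Proof.
move=> psiH AA a b; have [A1 A2] := AA a b.
by split; [exact: (cvg_subseq psiH A1) | exact: (cvg_subseq psiH A2)].
Qed.

Lemma mcvg_cst n k (A : 'M[R[i]]_(n, k)) : mcvg (fun=> A) A.
Proof. by move=> a b; apply: cvgc_cst. Qed.

Lemma mcvg_unique n k (A : nat -> 'M[R[i]]_(n, k)) A1 A2 :
  mcvg A A1 -> mcvg A A2 -> A1 = A2.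
Proof. by move=> A_1 A_2; apply/matrixP => a b; apply: cvgc_unique. Qed.

Lemma mcvgD n k (A B : nat -> 'M[R[i]]_(n, k)) A0 B0 :
  mcvg A A0 -> mcvg B B0 -> mcvg (fun j => A j + B j) (A0 + B0).
Proof.
move=> AA BB a b; rewrite mxE; under [fun=> _]funext do rewrite mxE.
exact: cvgcD.
Qed.

Lemma mcvgM n k p (A : nat -> 'M[R[i]]_(n, k)) (B : nat -> 'M_(k, p)) A0 B0 :
  mcvg A A0 -> mcvg B B0 -> mcvg (fun j => A j *m B j) (A0 *m B0).
Proof.
move=> AA BB a b; rewrite mxE; under [fun=> _]funext do rewrite mxE.
by apply: cvgc_sum => c; apply: cvgcM.
Qed.

Lemma mcvgN n k (A : nat -> 'M[R[i]]_(n, k)) A0 :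
  mcvg A A0 -> mcvg (fun j => - A j) (- A0).
Proof.
move=> AA a b; rewrite mxE -mulN1r; under [fun=> _]funext do rewrite mxE -mulN1r.
by apply: cvgcM => //; apply: cvgc_cst.
Qed.

Lemma mcvg_trC n k (A : nat -> 'M[R[i]]_(n, k)) A0 :
  mcvg A A0 -> mcvg (fun j => (A j) ^t*) (A0 ^t*).
Proof.
move=> AA a b; rewrite !mxE; under [fun=> _]funext do rewrite !mxE.
exact: cvgc_conj.
Qed.

Lemma mcvg_castmx n k n' k' (e : (n = n') * (k = k'))
    (A : nat -> 'M[R[i]]_(n, k)) A0 :
  mcvg A A0 -> mcvg (fun j => castmx e (A j)) (castmx e A0).
Proof.
by case: e => e1 e2; subst n' k' => AA; under [fun=> _]funext do rewrite castmx_id.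
Qed.

(** The shapes do not depend on [j]: either [conform_mx] is the identity throughout, or the sequence
    is constantly [Z]. *)
Lemma mcvg_conform n k n' k' (Z : 'M[R[i]]_(n', k')) (A : nat -> 'M_(n, k)) A0 :
  mcvg A A0 -> mcvg (fun j => conform_mx Z (A j)) (conform_mx Z A0).
Proof.
move=> AA; have [|/nandP ne] := boolP ((n == n') && (k == k')).
  case/andP=> /eqP e1 /eqP e2; subst n' k'; rewrite conform_mx_id.
  by under [fun=> _]funext do rewrite conform_mx_id.
rewrite nonconform_mx; last exact/orP.
rewrite (_ : (fun=> _) = fun=> Z); first exact: mcvg_cst.
by apply/funext => j; rewrite nonconform_mx //; apply/orP.
Qed.

Lemma normc_sq (z : R[i]) : normc z ^+ 2 = Re z ^+ 2 + Im z ^+ 2.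
Proof. by case: z => a b; rewrite /= sqr_sqrtr // addr_ge0 ?sqr_ge0. Qed.

Lemma mcvg_fnorm n k (A : nat -> 'M[R[i]]_(n, k)) A0 :
  mcvg A A0 -> (fun j => fnorm (A j)) @ \oo --> fnorm A0.
Proof.
move=> AA; apply: continuous_cvg; first exact: sqrt_continuous.
apply: cvgr_sum => a; apply: cvgr_sum => b; have [A1 A2] := AA a b.
rewrite normc_sq; under [fun=> _]funext do rewrite normc_sq.
by apply: cvgD; apply: cvgM.
Qed.

Lemma fnorm_ge_entry n k (A : 'M[R[i]]_(n, k)) a b :
  `|Re (A a b)| <= fnorm A /\ `|Im (A a b)| <= fnorm A.
Proof.
have le : Re (A a b) ^+ 2 + Im (A a b) ^+ 2 <= fnorm A ^+ 2.
  rewrite -normc_sq fnorm_sq (bigD1 a) //= (bigD1 b) //= -addrA lerDl.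
  by apply: addr_ge0; repeat (apply: sumr_ge0 => ? _); apply: sqr_ge0.
split; rewrite -ler_sqr ?nnegrE ?fnorm_ge0 // real_normK ?num_real //.
  by apply: le_trans le; rewrite lerDl sqr_ge0.
by apply: le_trans le; rewrite lerDr sqr_ge0.
Qed.

Lemma fnorm_mcvg n k (A : nat -> 'M[R[i]]_(n, k)) A0 :
  (fun j => fnorm (A j - A0)) @ \oo --> (0 : R) -> mcvg A A0.
Proof.
move=> AA a b; split; apply/cvgrPdist_le => e e0.
  move/cvgrPdist_le: AA => /(_ e e0); apply: filterS => j.
  rewrite sub0r normrN ger0_norm ?fnorm_ge0 //; apply: le_trans.
  have [+ _] := fnorm_ge_entry (A j - A0) a b.
  by rewrite !mxE ReD ReN distrC.
move/cvgrPdist_le: AA => /(_ e e0); apply: filterS => j.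
rewrite sub0r normrN ger0_norm ?fnorm_ge0 //; apply: le_trans.
have [_] := fnorm_ge_entry (A j - A0) a b.
by rewrite !mxE distrC; case: (A j a b) (A0 a b) => ? ? [].
Qed.

(** Links the norm convergence of [converges_on] with the entrywise one, for which the limit rules
    are proved. *)
Lemma mcvgP n k (A : nat -> 'M[R[i]]_(n, k)) A0 :
  (fun j => fnorm (A j - A0)) @ \oo --> (0 : R) <-> mcvg A A0.
Proof.
split=> [|AA]; first exact: fnorm_mcvg.
have /mcvg_fnorm := mcvgD AA (mcvgN (mcvg_cst A0)).
suff -> : fnorm (A0 - A0) = 0 by [].
rewrite subrr /fnorm big1 ?sqrtr0 // => a _; rewrite big1 // => b _.
by rewrite mxE Normc.normc0 expr0n.
Qed.

Lemma mcvg0_fnorm n k (A : nat -> 'M[R[i]]_(n, k)) :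
  (fun j => fnorm (A j)) @ \oo --> (0 : R) <-> mcvg A 0.
Proof. by rewrite -mcvgP; under [fun=> fnorm (_ - _)]funext do rewrite subr0. Qed.

End Limits.

(** * Limits of polar updates with vanishing gain *)

Section PolarLimit.
Variables (R : realType) (n k p : nat).
Variables (C : nat -> 'M[R[i]]_(n, p)) (X Y : nat -> 'M[R[i]]_(n, k)).
Variables (G : nat -> 'M[R[i]]_k) (C0 : 'M[R[i]]_(n, p)) (X0 : 'M[R[i]]_(n, k)).
Hypotheses (XS : forall j, stiefel (X j)) (YS : forall j, stiefel (Y j)).
Hypotheses (Gpsd : forall j, possemidef (G j)).
Hypotheses (HXG : forall j, C j *m (C j) ^t* *m X j = Y j *m G j).
Hypotheses (CC : mcvg C C0) (XX : mcvg X X0).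
Hypothesis gain0 : (fun j => polar_gain (C j) (X j) (Y j)) @ \oo --> (0 : R).

Let H0 := C0 *m C0 ^t*.

Let HH : mcvg (fun j => C j *m (C j) ^t* *m X j) (H0 *m X0).
Proof. by apply: mcvgM => //; apply: mcvgM => //; apply: mcvg_trC. Qed.

(** By [polar_diff_le] the squared norm is at most [|H X|], which converges, times the gain, which
    tends to zero. *)
Let E0 : mcvg (fun j => (Y j - X j) *m G j) 0.
Proof.
apply/mcvg0_fnorm.
have E2 : (fun j => fnorm ((Y j - X j) *m G j) ^+ 2) @ \oo --> (0 : R).
  apply: (@squeeze_cvgr _ _ _ _ (fun=> 0)
    (fun j => fnorm (C j *m (C j) ^t* *m X j) * polar_gain (C j) (X j) (Y j))).
  - apply: nearW => j; rewrite sqr_ge0 /=; exact: polar_diff_le.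
  - exact: cvg_cst.
  - rewrite -(mulr0 (fnorm (H0 *m X0))); apply: cvgM => //.
    exact: mcvg_fnorm.
suff : (fun j => Num.sqrt (fnorm ((Y j - X j) *m G j) ^+ 2)) @ \oo -->
    Num.sqrt (0 : R).
  rewrite sqrtr0; under [fun=> Num.sqrt _]funext do
    rewrite sqrtr_sqr (ger0_norm (fnorm_ge0 _)).
  by [].
by apply: continuous_cvg => //; apply: sqrt_continuous.
Qed.

(** The factors [G] are not assumed to converge. Since [X^H X = I], they equal
    [X^H (H X - (Y - X) G)], where every piece has a limit. *)
Let GG : mcvg G (X0 ^t* *m (H0 *m X0)).
Proof.
have -> : G = fun j => (X j) ^t* *m (C j *m (C j) ^t* *m X j - (Y j - X j) *m G j).
  by apply/funext => j; rewrite HXG mulmxBl opprB addrC subrK mulmxA XS mul1mx.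
apply: mcvgM; first exact: mcvg_trC.
by rewrite -[H0 *m X0]subr0; apply: mcvgD => //; apply: mcvgN.
Qed.

Lemma polar_limit_fixed : H0 *m X0 = X0 *m (X0 ^t* *m H0 *m X0).
Proof.
rewrite -[X0 ^t* *m _ *m _]mulmxA; apply: mcvg_unique HH _.
rewrite -[_ *m (X0 ^t* *m _)]add0r.
have -> : (fun j => C j *m (C j) ^t* *m X j) =
    fun j => (Y j - X j) *m G j + X j *m G j.
  by apply/funext => j; rewrite HXG mulmxBl subrK.
by apply: mcvgD => //; apply: mcvgM.
Qed.

Lemma stiefel_mul_cvg0 (Q : nat -> 'M[R[i]]_(n, k)) (Z : nat -> 'M[R[i]]_k) :
  (forall j, stiefel (Q j)) -> mcvg Z 0 -> mcvg (fun j => Q j *m Z j) 0.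
Proof.
move=> QS /mcvg0_fnorm Z0; apply/mcvg0_fnorm.
by under [fun=> _]funext do rewrite fnorm_mul_isometry //.
Qed.

(** Full rank of [H0 X0 = X0 L] makes [L] invertible, so it suffices that [Y L] tends to [X0 L]. *)
Lemma polar_limit_cvg : \rank (H0 *m X0) = k -> mcvg Y X0.
Proof.
set L := X0 ^t* *m H0 *m X0 => rk.
have Lu : L \in unitmx.
  rewrite -row_full_unit /row_full eqn_leq rank_leq_row -{1}rk polar_limit_fixed.
  exact: mxrankM_maxr.
have YL : mcvg (fun j => Y j *m L) (X0 *m L).
  (* No limit of [Y] is known yet, but [Y] preserves norms, so [Y (L - G)] tends to zero along with
     [L - G]. *)
  have -> : (fun j => Y j *m L) =
      fun j => C j *m (C j) ^t* *m X j + Y j *m (L - G j).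
    by apply/funext => j; rewrite HXG mulmxBr addrC subrK.
  rewrite -polar_limit_fixed -[H0 *m X0]addr0; apply: mcvgD => //.
  apply: stiefel_mul_cvg0 => //; rewrite -(subrr L).
  apply: mcvgD; first exact: mcvg_cst.
  by apply: mcvgN; rewrite /L -mulmxA.
rewrite -[X0](mulmxK Lu); under [Y]funext do rewrite -[Y _](mulmxK Lu).
by apply: mcvgM => //; apply: mcvg_cst.
Qed.

End PolarLimit.

(** * Continuity of [Cmx] and of the objective *)

Section TensorLimits.
Variables (R : realType) (m : nat) (n k : 'I_m -> nat).
Implicit Types (l : 'I_m).

Lemma cvg_mode_mul_seq (X : nat -> forall l, 'M[R[i]]_(k l, n l)) X0 r d
    (T : nat -> tensor R d) (T0 : tensor R d) :
  {in r, forall s, mcvg (X ^~ s) (X0 s)} ->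
  (forall i, cvgc (fun j => T j i) (T0 i)) ->
  forall i, cvgc (fun j => mode_mul_seq (X j) r (T j) i)
                 (mode_mul_seq X0 r T0 i).
Proof.
elim: r d T T0 => //= a r IH d T T0 XX TT; apply: IH => [s sr|i].
  by apply: XX; rewrite inE sr orbT.
rewrite ffunE; under [fun=> _]funext do rewrite ffunE.
apply: cvgc_sum => b; apply: cvgcM => //.
by apply: mcvg_conform; apply: XX; apply: mem_head.
Qed.

Variable B : tensor R n.
Variables (Q : nat -> factors R n k) (Q0 : factors R n k).

Lemma mcvg_Cmx l : (forall s, s != l -> mcvg (Q ^~ s) (Q0 s)) ->
  mcvg (fun j => Cmx B l (Q j)) (Cmx B l Q0).
Proof.
move=> QQ; apply: mcvg_castmx => a b; rewrite mxE.
under [fun=> _]funext do rewrite mxE.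
apply: (cvg_mode_mul_seq (X := fun j s => (Q j s) ^t*)
  (X0 := fun s => (Q0 s) ^t*)) => [s|i]; last exact: cvgc_cst.
by rewrite mem_filter => /andP[sl _]; apply: mcvg_trC; apply: QQ.
Qed.

Lemma cvg_objective l : (forall s, mcvg (Q ^~ s) (Q0 s)) ->
  (fun j => objective B (Q j)) @ \oo --> objective B Q0.
Proof.
move=> QQ; rewrite (objectiveE B Q0 l) expr2.
under [fun=> _]funext do rewrite (objectiveE B _ l) expr2.
have NN : (fun j => fnorm ((Q j l) ^t* *m Cmx B l (Q j))) @ \oo -->
    fnorm ((Q0 l) ^t* *m Cmx B l Q0).
  apply: mcvg_fnorm; apply: mcvgM; first exact: mcvg_trC.
  by apply: mcvg_Cmx => s _; apply: QQ.
exact: (cvgM NN NN).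
Qed.

End TensorLimits.

(** * Compactness, extraction of subsequences and series *)

Section Compactness.
Variable R : realType.

(** Coordinates are treated one at a time; each refinement of the subsequence keeps the limits
    already obtained. *)
Lemma bolzano_weierstrass_fin (T : finType) (x : nat -> T -> R) :
  (forall t, exists M, forall j, `|x j t| <= M) ->
  exists psi : nat -> nat, {homo psi : i j / (i < j)%N} /\
    forall t, cvgn (fun j => x (psi j) t).
Proof.
move=> xb; suff [psi [psiH cv]] : exists psi : nat -> nat,
    {homo psi : i j / (i < j)%N} /\
    forall t, t \in enum T -> cvgn (fun j => x (psi j) t).
  by exists psi; split=> // t; apply: cv; rewrite mem_enum.
elim: (enum T) => [|t s [psi [psiH cv]]].
  by exists id; split=> // t; rewrite in_nil.
have [f fH /cvg_ex[/= y fy]] : exists2 f : nat -> nat, increasing_seq f &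
    cvgn ((fun j => x (psi j) t) \o f).
  apply: bolzano_weierstrass; have [M xM] := xb t.
  exists M; split; first exact: num_real.
  by move=> z Mz j _ /=; apply: le_trans (xM _) (ltW Mz).
have fH' : {homo f : i j / (i < j)%N}.
  by move=> i j; rewrite !ltnNge -(fH j i).
exists (psi \o f); split=> [i j ij|u]; first by apply/psiH/fH'.
rewrite inE => /orP[/eqP ->|/cv /cvg_ex[z uz]]; first exact: (cvgP y).
by apply: (cvgP z); apply: (cvg_subseq fH' uz).
Qed.

Lemma stiefel_compact m (n k : 'I_m -> nat) (Q : nat -> factors R n k) :
  (forall j l, stiefel (Q j l)) ->
  exists (psi : nat -> nat) (Q0 : factors R n k),
    {homo psi : i j / (i < j)%N} /\
    forall l, mcvg (fun j => Q (psi j) l) (Q0 l).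
Proof.
move=> QS.
(* One real coordinate for the real and one for the imaginary part of each entry of each factor, all
   bounded by the norm [sqrt (k l)] of that factor. *)
pose T := ({l : 'I_m & 'I_(n l) * 'I_(k l)} * bool)%type.
pose x j (t : T) := let z := Q j (tag t.1) (tagged t.1).1 (tagged t.1).2 in
  if t.2 then complex.Re z else complex.Im z.
have [t|psi [psiH cv]] := @bolzano_weierstrass_fin T x.
  exists (Num.sqrt (k (tag t.1))%:R) => j; rewrite -(fnorm_stiefel (QS j _)).
  rewrite sqrtr_sqr (ger0_norm (fnorm_ge0 _)) /x.
  have [] := fnorm_ge_entry (Q j (tag t.1)) (tagged t.1).1 (tagged t.1).2.
  by case: ifP.
pose y t := lim (x (psi j) t @[j --> \oo]).
exists psi, (fun l => \matrix_(a, b) Complex (y (Tagged _ (a, b), true))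
  (y (Tagged _ (a, b), false))); split=> // l a b; rewrite mxE; split.
  exact: (cv (Tagged (fun l => 'I_(n l) * 'I_(k l))%type (a, b), true)).
exact: (cv (Tagged (fun l => 'I_(n l) * 'I_(k l))%type (a, b), false)).
Qed.

Lemma infinitely_often_subseq (A : nat -> Prop) :
  (forall N, exists2 j, (N <= j)%N & A j) ->
  exists psi : nat -> nat, {homo psi : i j / (i < j)%N} /\ forall j, A (psi j).
Proof.
move=> Aoo; have /choice[h hP] : forall N, exists j, (N <= j)%N /\ A j.
  by move=> N; have [j] := Aoo N; exists j.
(* [h N] picks an index of [A] that is at least [N]; the successor makes the iterates strictly
   increase. *)
exists (fun j => iter j (h \o S) (h 0%N)); split; last first.
  by case=> [|j] /=; apply: (hP _).2.
by apply: homo_ltn => [? ? ?|j /=]; [apply: ltn_trans | apply: (hP _).1].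
Qed.

Lemma cvg_series_telescope_le (u f : nat -> R) M :
  (forall j, 0 <= u j) -> (forall j, u j <= f j.+1 - f j) ->
  (forall j, f j <= M) -> cvgn (series u).
Proof.
move=> u0 uf fM; apply: nondecreasing_is_cvgn.
  apply/nondecreasing_seqP => j.
  by rewrite /series /= big_nat_recr //= lerDl.
exists (M - f 0%N) => _ [j _ <-].
rewrite /series /= (@le_trans _ _ (f j - f 0%N)) ?lerD2r //.
by rewrite -telescope_sumr // ler_sum.
Qed.

Lemma fnorm0_eq0 n k (A : 'M[R[i]]_(n, k)) : fnorm A = 0 -> A = 0.
Proof.
move=> A0; apply/matrixP => a b; rewrite mxE.
have := fnorm_ge_entry A a b; rewrite A0 !normr_le0.
by case: (A a b) => x y /= [/eqP -> /eqP ->].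
Qed.

Lemma unitmx_rank_mul (F : fieldType) n k (X : 'M[F]_(n, k)) (L : 'M_k) :
  \rank (X *m L) = k -> L \in unitmx.
Proof.
move=> rk; rewrite -row_full_unit /row_full eqn_leq rank_leq_row /= -[leqLHS]rk.
exact: mxrankM_maxr.
Qed.

End Compactness.

(** * The alternating iteration *)

Section AlternatingIteration.
Variables (R : realType) (m : nat) (n k : 'I_m -> nat).
Variables (B : tensor R n) (P : nat -> factors R n k).
Hypothesis hP : ASI_sequence B P.
Implicit Types (l : 'I_m).

Lemma ASI_stiefel j l : stiefel (P j l).
Proof. by case: j => [|j]; [apply: hP.1 | have [G []] := hP.2 j l]. Qed.

(* The factors after the first [t] of the [m] updates of step [j]. *)
Definition sweep j (t : nat) : factors R n k :=
  fun s => if (s < t)%N then P j.+1 s else P j s.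

Lemma mcvg_sweep (chi : nat -> nat) (t : nat) (s : 'I_m) Z :
  ((s < t)%N -> mcvg (fun j => P (chi j).+1 s) Z) ->
  (~~ (s < t)%N -> mcvg (fun j => P (chi j) s) Z) ->
  mcvg (fun j => sweep (chi j) t s) Z.
Proof. by rewrite /sweep; case: (s < t)%N => [/(_ isT)|_ /(_ isT)]. Qed.

(** [sweep j l] unfolds to the same function as [mix l (P j.+1) (P j)], so the bounds for one polar
    update apply to [H_iter] as it stands. *)
Definition gain j l :=
  polar_gain (Cmx B l (sweep j l)) (P j l) (P j.+1 l).

(** The update of mode [l] leaves [Cmx B l] unchanged, so [objectiveE] at [l] gives both values of
    the objective. *)
Lemma gain_objective j l :
  gain j l = objective B (sweep j l.+1) - objective B (sweep j l).
Proof.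
have eC : Cmx B l (sweep j l.+1) = Cmx B l (sweep j l).
  apply: eq_Cmx => s sl; rewrite /sweep ltnS leq_eqVlt.
  by rewrite val_eqE (negPf sl).
have e1 : sweep j l.+1 l = P j.+1 l by rewrite /sweep ltnSn.
have e0 : sweep j l l = P j l by rewrite /sweep ltnn.
by rewrite /gain /polar_gain !(objectiveE B _ l) eC e1 e0.
Qed.

Lemma polar_ASI j l : exists2 G, possemidef G &
  Cmx B l (sweep j l) *m (Cmx B l (sweep j l)) ^t* *m P j l = P j.+1 l *m G.
Proof. by have [G [_ Gpsd HG]] := hP.2 j l; exists G. Qed.

Lemma gain_ge0 j l : 0 <= gain j l.
Proof.
have [G Gpsd HG] := polar_ASI j l.
exact: (polar_gain_ge0 (ASI_stiefel j l) (ASI_stiefel j.+1 l) Gpsd HG).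
Qed.

Lemma objective_sweep_mono j t1 t2 : (t1 <= t2 <= m)%N ->
  objective B (sweep j t1) <= objective B (sweep j t2).
Proof.
case/andP; elim: t2 => [|t IH]; first by rewrite leqn0 => /eqP ->.
rewrite leq_eqVlt ltnS => /orP[/eqP -> //|t1t tm].
apply: le_trans (IH t1t (ltnW tm)) _; rewrite -subr_ge0.
by rewrite -(gain_objective j (Ordinal tm)) gain_ge0.
Qed.

(** The increase over step [j] is the sum of the gains of its [m] updates, all nonnegative. *)
Lemma gain_le j l : gain j l <= objective B (P j.+1) - objective B (P j).
Proof.
have -> : P j.+1 = sweep j m.
  by apply: functional_extensionality_dep => s; rewrite /sweep ltn_ord.
have -> : objective B (P j) = objective B (sweep j 0) by [].
rewrite gain_objective; apply: lerB; apply: objective_sweep_mono.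
  by rewrite leqnn andbT ltn_ord.
exact: ltnW.
Qed.

Lemma objective_nondecreasing :
  {homo (fun j => objective B (P j)) : i j / (i <= j)%N >-> i <= j}.
Proof.
apply/nondecreasing_seqP => j.
have -> : P j.+1 = sweep j m.
  by apply: functional_extensionality_dep => s; rewrite /sweep ltn_ord.
by apply: (@objective_sweep_mono j 0 m); rewrite leqnn.
Qed.

Section Subsequence.
Variables (l0 : 'I_m) (chi : nat -> nat) (Q : factors R n k).
Hypothesis chiH : {homo chi : i j / (i < j)%N}.
Hypothesis PQ : forall l, mcvg (fun j => P (chi j) l) (Q l).

(** A monotone sequence lies below the limit of any of its subsequences, here [objective B Q] by
    continuity. The bound serves both (a) and the telescoping in (e). *)
Lemma objective_le_limit j : objective B (P j) <= objective B Q.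
Proof.
have fQ := cvg_objective (B := B) l0 PQ.
rewrite -(cvg_lim _ fQ) //.
apply: le_trans (objective_nondecreasing (homo_ltn_ge chiH j)) _.
apply: (nondecreasing_cvgn_le (u_ := fun j => objective B (P (chi j)))).
  move=> i1 i2 i12; apply: objective_nondecreasing.
  exact: (ltnW_homo chiH).
exact: cvgP fQ.
Qed.

Lemma cvg_objective_ASI : cvgn (fun j => objective B (P j)).
Proof.
apply: nondecreasing_is_cvgn; first exact: objective_nondecreasing.
by exists (objective B Q) => _ [j _ <-]; apply: objective_le_limit.
Qed.

Lemma stiefel_limit l : stiefel (Q l).
Proof.
apply: (mcvg_unique (A := fun j => (P (chi j) l) ^t* *m P (chi j) l)).
  by apply: mcvgM => //; apply: mcvg_trC.
by under [fun=> _]funext do rewrite ASI_stiefel; apply: mcvg_cst.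
Qed.

Lemma cvg_gain l : (fun j => gain (chi j) l) @ \oo --> (0 : R).
Proof.
have /cvg_ex[/= y fy] := cvg_objective_ASI.
apply: (@squeeze_cvgr _ _ _ _ (fun=> 0)
  (fun j => objective B (P (chi j).+1) - objective B (P (chi j)))).
- by apply: nearW => j; rewrite gain_ge0 gain_le.
- exact: cvg_cst.
- rewrite -(subrr y); apply: cvgB.
    exact: (cvg_subseq (psi := S \o chi) (fun i j ij => chiH ij) fy).
  exact: (cvg_subseq chiH fy).
Qed.

Section Mode.
Variables (l : 'I_m) (Q' : factors R n k).
Hypothesis sweepQ : forall s, s != l -> mcvg (fun j => sweep (chi j) l s) (Q' s).

(** [Q'] collects the limits of the other factors as the update of mode [l] sees them. It mixes new
    and old limits in (b) and is [Q] itself in [ASI_limit_next]. *)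
Lemma ASI_limit_step :
  Hmx B l Q' *m Q l = Q l *m ((Q l) ^t* *m Hmx B l Q' *m Q l) /\
  (\rank (Hmx B l Q' *m Q l) = k l -> mcvg (fun j => P (chi j).+1 l) (Q l)).
Proof.
have /choice[G hG] : forall j, exists G, possemidef G /\
    Cmx B l (sweep (chi j) l) *m (Cmx B l (sweep (chi j) l)) ^t* *m P (chi j) l =
    P (chi j).+1 l *m G.
  by move=> j; have [G] := polar_ASI (chi j) l; exists G.
have XS j := ASI_stiefel (chi j) l; have YS j := ASI_stiefel (chi j).+1 l.
have Gpsd j := (hG j).1; have HG j := (hG j).2.
have CC := mcvg_Cmx B sweepQ; have gain0 := cvg_gain l.
split; first exact: (polar_limit_fixed XS YS Gpsd HG CC).
exact: (polar_limit_cvg XS YS Gpsd HG CC).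
Qed.

End Mode.

(** Strong induction on [l]: once the updated factors before [l] tend to those of [Q], the update of
    mode [l] sees [Q] in the limit, and full rank applies. The bound [t] is [m.-1] in (c) and [m] in
    (d). *)
Lemma ASI_limit_next (t : nat) :
  (forall l, (l < t)%N -> \rank (Hmx B l Q *m Q l) = k l) ->
  forall l, (l < t)%N -> mcvg (fun j => P (chi j).+1 l) (Q l).
Proof.
move=> rk l; have [N] := ubnP l; elim: N l => // N IH l lN lt.
apply: (ASI_limit_step (Q' := Q) _).2; last exact: rk.
move=> s _; apply: mcvg_sweep => // sl.
by apply: IH; [apply: leq_trans sl lN | apply: ltn_trans sl lt].
Qed.

End Subsequence.

Lemma ASI_converges Q : 'I_m -> isolated_accumulation P Q ->
  (forall l, \rank (Hmx B l Q *m Q l) = k l) -> converges_on predT P Q.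
Proof.
move=> l0 [[phi [phiH phiQ]] [eps eps0 iso]] rk l _.
(* [d <= e] gives the conclusion; [d < eps] keeps even the closed ball of radius [d] inside the
   isolating neighborhood. *)
apply/cvgrPdist_lt => e e0; pose d := Num.min e (eps / 2).
have d0 : 0 < d by rewrite lt_min e0 divr_gt0.
have d_eps : d < eps.
  by rewrite gt_min; apply/orP; right; rewrite ltr_pdivrMr // ltr_pMr // ltr1n.
pose U j := forall s, fnorm (P j s - Q s) < d.
have U_eventually (chi : nat -> nat) :
    (forall s, mcvg (fun j => P (chi j) s) (Q s)) ->
    exists N, forall j, (N <= j)%N -> U (chi j).
  move=> chiQ; have : \forall j \near \oo, forall s, fnorm (P (chi j) s - Q s) < d.
    apply: filter_forall => s; have /mcvgP/cvgrPdist_lt/(_ d d0) := chiQ s.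
    by apply: filterS => j; rewrite sub0r normrN ger0_norm ?fnorm_ge0.
  by case=> N _ NU; exists N => j Nj; apply: NU.
(* Otherwise there are infinitely many exit times [f j], at which the ball contains the iterate but
   not its successor. *)
have [N NU] : exists N, forall j, (N <= j)%N -> U j -> U j.+1.
  apply: contrapT => noN.
  have [N|f [fH fA]] := @infinitely_often_subseq (fun j => U j /\ ~ U j.+1).
    apply: contrapT => noj; apply: noN; exists N => j Nj Uj.
    by apply: contrapT => nU; apply: noj; exists j.
  have [psi [Q0 [psiH PQ0]]] :=
    stiefel_compact (fun j s => ASI_stiefel (f j) s).
  pose chi := f \o psi.
  have chiH : {homo chi : i j / (i < j)%N} by move=> i j ij; apply/fH/psiH.
  (* The limit [Q0] of the iterates at exit times is an accumulation point in the closed ball, so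
     isolation identifies it with [Q]. *)
  have Q0Q s : Q0 s = Q s.
    apply: iso => [|{}s].
      by exists chi; split=> // {}s _; apply/mcvgP; apply: PQ0.
    apply: le_lt_trans d_eps.
    have cQ := mcvg_fnorm (mcvgD (PQ0 s) (mcvgN (mcvg_cst (Q s)))).
    apply: (ler_cvg_to cQ (cvg_cst d)).
    by apply: nearW => j; apply: ltW; apply: (fA (psi j)).1.
  have chiQ s : mcvg (fun j => P (chi j) s) (Q s) by rewrite -Q0Q; apply: PQ0.
  (* Full rank in all modes makes the successors tend to [Q] too, so they eventually lie in the
     ball: a contradiction. *)
  have [s|N Nchi] := U_eventually (S \o chi).
    exact: (ASI_limit_next l0 chiH chiQ (t := m) (fun l _ => rk l) (ltn_ord s)).
  exact: (fA (psi N)).2 (Nchi N (leqnn N)).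
have [s|N' N'phi] := U_eventually phi; first by apply/mcvgP; apply: phiQ.
(* [phi j0] is past [N], and the iterate there is in the ball; by [NU] no later iterate leaves
   it. *)
pose j0 := maxn N N'.
exists (phi j0) => // j /= j0j.
have UJ : U j.
  elim: j j0j => [|j IH].
    by rewrite leqn0 => /eqP <-; apply: N'phi; apply: leq_maxr.
  rewrite leq_eqVlt => /orP[/eqP <-|j0j]; first by apply: N'phi; apply: leq_maxr.
  apply: NU; last exact: IH.
  apply: leq_trans (leq_maxl N N') _; apply: leq_trans (homo_ltn_ge phiH _) _.
  by rewrite -ltnS.
rewrite sub0r normrN ger0_norm ?fnorm_ge0 // (lt_le_trans (UJ l)) //.
by rewrite ge_min lexx.
Qed.

End AlternatingIteration.

Theorem theorem5p1 (R : realType) (m : nat) (hm : (2 <= m)%N)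
    (n k : 'I_m -> nat) (hk : forall l, (1 <= k l <= n l)%N)
    (B : tensor R n) (P : nat -> factors R n k) (hP : ASI_sequence B P)
    (Pstar : factors R n k) (phi : nat -> nat)
    (hphi : {homo phi : i j / (i < j)%N})
    (hPstar : converges_on predT (fun j => P (phi j)) Pstar)
    (* Only the components of Phat other than the last are constrained, and
       only these are used below. *)
    (Phat : factors R n k)
    (hPhat : accumulation_on (fun l : 'I_m => (l.+1 < m)%N)
               (fun j => P (phi j).+1) Phat) :
  let Hstar l := Hmx B l Pstar in
  let Hhat l := Hmx B l (mix l Phat Pstar) in
  let Lstar l := (Pstar l) ^t* *m Hstar l *m Pstar l in
  let Lhat l := (Pstar l) ^t* *m Hhat l *m Pstar l in
  let L j l := (P j l) ^t* *m H_iter B P l j *m P j l in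
  (* (a) *)
  ({homo (fun j => objective B (P j)) : i j / (i <= j)%N >-> i <= j} /\
   cvgn (fun j => objective B (P j))) /\
  (* (b) *)
  (forall l : 'I_m,
     polar_decomposition (Hhat l *m Pstar l) (Pstar l) (Lhat l)) /\
  (* (c) *)
  ((forall l : 'I_m, (l.+1 < m)%N -> \rank (Hstar l *m Pstar l) = k l) ->
   (forall l : 'I_m, (l.+1 < m)%N -> Phat l = Pstar l) /\
   (forall l : 'I_m, Hstar l *m Pstar l = Pstar l *m Lstar l) /\
   (forall l : 'I_m, (l.+1 < m)%N -> posdef (Lstar l)) /\
   (forall l : 'I_m, l.+1 = m -> possemidef (Lstar l))) /\
  (* (d) *)
  (isolated_accumulation P Pstar ->
   (forall l : 'I_m, \rank (Hstar l *m Pstar l) = k l) ->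
   converges_on predT P Pstar) /\
  (* (e); a term of the second series with [H_iter B P l j = 0] is 0, since
     x / 0 = 0 in a [realType] *)
  (forall l : 'I_m,
     cvgn (series (fun j =>
       sigma_min (H_iter B P l j *m P j l)
       * sinTheta_norm (P j.+1 l) (P j l) ^+ 2)) /\
     cvgn (series (fun j =>
       sigma_min (H_iter B P l j *m P j l)
       * (fnorm (H_iter B P l j *m P j l - P j l *m L j l) ^+ 2
          / fnorm (H_iter B P l j) ^+ 2)))).
Proof.
(* Some mode is required to express the objective through [objectiveE]. *)
pose l0 : 'I_m := Ordinal (ltn_trans (ltnSn 0) hm).
have phiP l : mcvg (fun j => P (phi j) l) (Pstar l).
  by apply/mcvgP; apply: hPstar.
have [psi [psiH psiP]] := hPhat.
(* Along [chi] the current factors tend to [Pstar] and, except for the last mode, the next ones tend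
   to [Phat]. *)
pose chi := phi \o psi.
have chiH : {homo chi : i j / (i < j)%N} by move=> i j ij; apply/hphi/psiH.
have chiP l : mcvg (fun j => P (chi j) l) (Pstar l).
  exact: (mcvg_subseq psiH (phiP l)).
have chiP1 (l : 'I_m) : (l.+1 < m)%N -> mcvg (fun j => P (chi j).+1 l) (Phat l).
  by move=> lm; apply/mcvgP; apply: psiP.
have PS := stiefel_limit hP chiP.
(* The compression of [Hmx] is a Gram matrix, hence positive semidefinite. *)
have gramE (Q : factors R n k) l : (Pstar l) ^t* *m Hmx B l Q *m Pstar l =
    ((Cmx B l Q) ^t* *m Pstar l) ^t* *m ((Cmx B l Q) ^t* *m Pstar l).
  by rewrite trmxC_mul trmxCK !mulmxA.
have psd (Q : factors R n k) l : possemidef ((Pstar l) ^t* *m Hmx B l Q *m Pstar l).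
  by rewrite gramE; apply: possemidef_gram.
move=> Hstar Hhat Lstar Lhat L.
(* Only modes [s < l] are already updated, and these satisfy [s.+1 < m], so the last component of
   [Phat] never occurs. *)
have fixed l : Hhat l *m Pstar l = Pstar l *m Lhat l.
  apply: (ASI_limit_step hP l0 chiH chiP _).1 => s _.
  rewrite /mix; apply: mcvg_sweep => [sl|/negPf -> //].
  by rewrite sl; apply: chiP1; apply: leq_ltn_trans sl (ltn_ord l).
split; first by split; [exact: objective_nondecreasing |
  exact: (cvg_objective_ASI hP l0 chiH chiP)].
split; first by move=> l; split; [exact: PS | exact: psd | exact: fixed].
split.
  move=> rk.
  have hatE (l : 'I_m) : (l.+1 < m)%N -> Phat l = Pstar l.
    move=> lm; apply: mcvg_unique (chiP1 l lm) _.
    apply: (ASI_limit_next hP l0 chiH chiP (t := m.-1)) => [s sm|].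
      by apply: rk; rewrite -ltn_predRL.
    by rewrite ltn_predRL.
  have HE l : Hhat l = Hstar l.
    rewrite /Hhat /Hstar /Hmx (eq_Cmx B (Q := Pstar)) // => s _.
    rewrite /mix; case: ifP => // sl.
    by apply: hatE; apply: leq_ltn_trans sl (ltn_ord l).
  have fixedS l : Hstar l *m Pstar l = Pstar l *m Lstar l.
    by rewrite -HE fixed /Lhat HE.
  split=> //; split=> //; split=> l lm; last exact: psd.
  have Lu : Lstar l \in unitmx.
    by apply: (unitmx_rank_mul (X := Pstar l)); rewrite -fixedS; apply: rk.
  split=> [|x x0]; first by have [] := psd Pstar l.
  (* The form is [|C^H P x|^2] with [C = Cmx B l Pstar] and [P = Pstar l]. If it vanished, so would
     [Lstar l *m x], against invertibility. *)
  rewrite /Lstar gramE mulmxA -trmxC_mul -mulmxA fnorm_col ltcR exprn_gt0 //.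
  rewrite lt0r fnorm_ge0 andbT; apply: contraNneq x0 => /fnorm0_eq0 Cx.
  rewrite -(mulKmx Lu x) /Lstar gramE -[_ *m _ *m x]mulmxA Cx.
  by rewrite !mulmx0.
split; first by move=> iso rk; apply: (ASI_converges hP l0).
move=> l.
have bound := objective_le_limit hP l0 chiH chiP.
have sigma0 j : 0 <= sigma_min (H_iter B P l j *m P j l).
  by have [] := sigma_min_le (H_iter B P l j *m P j l) 0 (hk l).
split; apply: (@cvg_series_telescope_le _ _ _ (objective B Pstar) _ _ bound) => j.
- by rewrite mulr_ge0 ?sqr_ge0.
- apply: le_trans (gain_le hP j l); have [G Gpsd HG] := polar_ASI hP j l.
  exact: (sinTheta_step_le (ASI_stiefel hP j l) (ASI_stiefel hP j.+1 l) Gpsd HG).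
- by rewrite mulr_ge0 // divr_ge0 ?sqr_ge0.
- apply: le_trans (gain_le hP j l); have [G Gpsd HG] := polar_ASI hP j l.
  exact: (residual_step_le (ASI_stiefel hP j l) (ASI_stiefel hP j.+1 l) Gpsd HG).
Qed.
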